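(* In the setting described in the context, suppose that: (i) $K:=\max_{f\in\mathcal F}\|f-f^0\|_\infty<\infty$; (ii) there are a constant $m_n>0$ and a strictly increasing function $\mathcal J$ on $[\tau_{\min},\infty)$ with $\mathcal J(\tau_{\min})=0$ such that the function $\Phi_{\mathcal J}(u):=[\mathcal J^{-1}(u)]^2$, $u>0$, is strictly convex, and $\mathbf E(s)\le \mathcal J(s)/m_n$ for all $s\ge\tau_{\min}$; (iii) the quadratic curvature condition holds with constant $C>0$: $P(f-f^0)\ge \sigma^2(f-f^0)/C^2$ for all $f\in\mathcal F$; (iv) the right-sided second order margin condition holds in the range $(s_0+\underline\delta,\tau_{\max}]$ with margin function $G$, whose convex conjugate is $G^*$. Let $r_0\ge 0$ be given by $r_0^2:=2C^2\,\Phi^*_{\mathcal J}\bigl(4K/(m_nC^2)\bigr)$. Then there are a constant $c_0=c_0(C,K)$ (depending only on $C$ and $K$) and a function $\delta:(0,\infty)\to(0,\infty)$ such that for all $t>0$ $$G(\delta(t))\le G^*\Bigl(c_0\sqrt{\tfrac{t+\log(1+\sqrt{n\tau_{\max}^2})}{n}}\Bigr)+c_0\Bigl((s_0+r_0)\sqrt{\tfrac{t+\log(1+\sqrt{n\tau_{\max}^2})}{n}}+\tfrac{t+\log(1+\sqrt{n\tau_{\max}^2})}{n}\Bigr),$$ and such that $$\mathbb P\bigl(\tau_{\max}\ge\tau(\hat f)>s_0+\max\{\underline\delta,\delta(t)\}\bigr)\le\exp[-t]\qquad\text{for all }t>0.$$ If, in fact, the two-sided second order margin condition holds in the range $[\tau_{\min},s_0)\cup(s_0+\underline\delta,\tau_{\max}]$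 with margin function $G$, then $$\mathbb P\bigl(|\tau(\hat f)-s_0|>\max\{\underline\delta,\delta(t)\},\ \tau(\hat f)\le\tau_{\max}\bigr)\le 2\exp[-t]\qquad\text{for all }t>0.$$
   Context: $X_1,\dots,X_n$ are independent random variables with values in a space $\mathcal X$; $\mathcal F$ is a class of real-valued functions on $\mathcal X$; $\mathrm{pen}:\mathcal F\to[0,\infty)$ is a penalty. For a function $f$ on $\mathcal X$: $P_nf:=\frac1n\sum_{i=1}^nf(X_i)$, $Pf:=\mathbb E P_nf$, and $\sigma^2(f):=\frac1n\sum_{i=1}^n\bigl[\mathbb E f^2(X_i)-(\mathbb E f(X_i))^2\bigr]$. Put $$\hat f:=\arg\min_{f\in\mathcal F}\{P_nf+\mathrm{pen}(f)\},\quad f^0:=\arg\min_{f\in\mathcal F}Pf,\quad \tau^2(f):=P(f-f^0)+\mathrm{pen}(f),\quad \tau_{\min}^2:=\min_{f\in\mathcal F}\tau^2(f),$$ with $\tau(f),\tau_{\min}\ge0$ the square roots. For $s\ge\tau_{\min}$ let $\mathcal F_s:=\{f\in\mathcal F:\tau(f)\le s\}$, $\hat{\mathbf E}_n(s):=\max_{f\in\mathcal F_s}(P_n-P)(f^0-f)$, $\mathbf E(s):=\mathbb E\,\hat{\mathbf E}_n(s)$, and $s_0:=\arg\min_{s\ge\tau_{\min}}\{s^2-\mathbf E(s)\}$. Standing convention: all argmins/argmaxs exist and are unique. Second order margin condition: let $G$ be a strictly convex increasing function (on $[0,\infty)$) with $G(0)=0$, and let $\underline\delta\ge0$ and $\tau_{\max}\ge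 s_0+\underline\delta$ be constants. If $s_0>\tau_{\min}$, the (two-sided) second order margin condition holds in the range $[\tau_{\min},s_0)\cup(s_0+\underline\delta,\tau_{\max}]$ with margin function $G$ if $$[s^2-\mathbf E(s)]-[s_0^2-\mathbf E(s_0)]\ge G(|s-s_0|)$$ for all $s$ in this range. The right-sided condition in the range $(s_0+\underline\delta,\tau_{\max}]$ requires this inequality only for all $s\in(s_0+\underline\delta,\tau_{\max}]$. Convex conjugates: $\Phi^*_{\mathcal J}(v):=\sup_{u>0}\{vu-\Phi_{\mathcal J}(u)\}$ and likewise $G^*(v):=\sup_{u>0}\{vu-G(u)\}$.
   Formalization: Measurability is made explicit: each f in F and τ(f̂) are measurable, and for every s ≥ τ_min the maximum over F_s defining Ê_n(s) equals the supremum over a countable subclass of F_s; without such separability E(s) may be undefined or Ê_n(s) fail to concentrate. *)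

(* Defs.v *)
From HB Require Import structures.
From mathcomp Require Import all_boot all_order all_algebra.
From mathcomp Require Import all_classical all_reals all_analysis.

Set Implicit Arguments.
Unset Strict Implicit.
Unset Printing Implicit Defensive.

Import Order.TTheory GRing.Theory Num.Theory.

Local Open Scope classical_set_scope.
Local Open Scope ring_scope.

Definition unique_argmin (R : realType) (T : Type) (A : set T) (g : T -> R)
    (x : T) : Prop :=
  A x /\ forall y, A y -> y <> x -> g x < g y.

Definition is_max (disp : Order.disp_t) (T : porderType disp) (A : set T)
    (m : T) : Prop :=
  A m /\ ubound A m.

Definition is_min (disp : Order.disp_t) (T : porderType disp) (A : set T)
    (m : T) : Prop :=
  A m /\ lbound A m.

Definition strictly_convex_on (R : realType) (D : set R) (f : R -> R) : Prop :=
  forall x y l, D x -> D y -> x != y -> 0 < l < 1 ->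
    f (l * x + (1 - l) * y) < l * f x + (1 - l) * f y.

(* Valued in \bar R: a strictly convex function may have linear growth, in
   which case its conjugate is +oo at large v. *)
Definition convex_conjugate (R : realType) (f : R -> R) (v : R) : \bar R :=
  ereal_sup [set (v * u - f u)%:E | u in `]0, +oo[].

Definition sup_norm (R : realType) (T : Type) (g : T -> R) : \bar R :=
  ereal_sup (range (fun x => `|g x|%:E)).

Definition mutually_independent (R : realType) (d d' : measure_display)
    (Omega : measurableType d) (T : measurableType d') (P : probability Omega R)
    (n : nat) (X : 'I_n -> {mfun Omega >-> T}) : Prop :=
  forall (J : {set 'I_n}) (A : 'I_n -> set T), (forall i, measurable (A i)) ->
    P (\bigcap_(i in [set` J]) (X i @^-1` A i)) =
    (\prod_(i in J) P (X i @^-1` A i))%E.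

Section EmpiricalProcess.
Context (R : realType) (d d' : measure_display) (Omega : measurableType d)
  (T : measurableType d') (P : probability Omega R) (n : nat)
  (X : 'I_n -> {mfun Omega >-> T}).

Definition emp_mean (f : T -> R) (w : Omega) : R := n%:R^-1 * \sum_(i < n) f (X i w).

Definition pop_mean (f : T -> R) : R := fine 'E_P[emp_mean f].

Definition avg_var (f : T -> R) : R :=
  n%:R^-1 * \sum_(i < n)
    (fine 'E_P[fun w => f (X i w) ^+ 2] - fine 'E_P[fun w => f (X i w)] ^+ 2).

Definition tau2 (f0 : T -> R) (pen : (T -> R) -> R) (f : T -> R) : R := pop_mean (f \- f0) + pen f.

Definition tau (f0 : T -> R) (pen : (T -> R) -> R) (f : T -> R) : R :=
  Num.sqrt (tau2 f0 pen f).

Definition sublevel (F : set (T -> R)) (f0 : T -> R) (pen : (T -> R) -> R)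
    (s : R) : set (T -> R) :=
  [set f | F f /\ tau f0 pen f <= s].

Definition deviation (f0 f : T -> R) (w : Omega) : R :=
  emp_mean (f0 \- f) w - pop_mean (f0 \- f).

Definition max_deviation (f0 : T -> R) (F : set (T -> R)) (w : Omega) : R :=
  sup [set deviation f0 f w | f in F].

Definition emp_E (F : set (T -> R)) (f0 : T -> R) (pen : (T -> R) -> R)
    (s : R) : Omega -> R :=
  max_deviation f0 (sublevel F f0 pen s).

Definition mean_E (F : set (T -> R)) (f0 : T -> R) (pen : (T -> R) -> R)
    (s : R) : R :=
  fine 'E_P[emp_E F f0 pen s].

End EmpiricalProcess.

(* pinv is the inverse of J restricted to [tau_min, +oo[; it is meaningful at
   every u > 0 when J maps [tau_min, +oo[ injectively and covers ]0, +oo[. *)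
Definition Phi (R : realType) (tau_min : R) (J : R -> R) (u : R) : R :=
  'pinv_(fun=> 0) `[tau_min, +oo[ J u ^+ 2.

Definition margin_at (R : realType) (E : R -> R) (s0 : R) (G : R -> R)
    (s : R) : Prop :=
  G `|s - s0| <= (s ^+ 2 - E s) - (s0 ^+ 2 - E s0).

Definition right_margin (R : realType) (E : R -> R) (s0 delta_ tau_max : R)
    (G : R -> R) : Prop :=
  forall s, s0 + delta_ < s <= tau_max -> margin_at E s0 G s.

Definition two_sided_margin (R : realType) (E : R -> R)
    (tau_min s0 delta_ tau_max : R) (G : R -> R) : Prop :=
  forall s, tau_min <= s < s0 \/ s0 + delta_ < s <= tau_max ->
    margin_at E s0 G s.

Definition margin_function (R : realType) (G : R -> R) : Prop :=
  [/\ strictly_convex_on `[0, +oo[ G,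
      {in `[0, +oo[ &, {homo G : x y / x < y}} & G 0 = 0].

(* The supremum over the possibly uncountable class F may be taken over a
   countable subclass. Measurability of w |-> max_deviation f0 F w on Omega
   would not suffice: the sigma-algebra of Omega may be finer than the one
   generated by the X i. *)
Definition separable_deviation (R : realType) (d d' : measure_display)
    (Omega : measurableType d) (T : measurableType d') (P : probability Omega R)
    (n : nat) (X : 'I_n -> {mfun Omega >-> T}) (f0 : T -> R)
    (F : set (T -> R)) : Prop :=
  exists D : set (T -> R), [/\ D !=set0, D `<=` F, countable D &
    forall w, max_deviation P X f0 F w = max_deviation P X f0 D w].

Definition rate (R : realType) (n : nat) (tau_max t : R) : R :=
  (t + ln (1 + Num.sqrt (n%:R * tau_max ^+ 2))) / n%:R.

(* Main.v *)
(** The minimizer [fhat] also minimizes [s^2 - E_n(s)] along [s = tau(fhat)], where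
    [E_n(s)] is the maximal deviation over the sublevel set of radius [s]; hence the
    excess of [s^2 - E(s)] at [tau(fhat)] over its minimum at [s0] is at most the
    increment between [s0] and [tau(fhat)] of the fluctuation [E_n - E].  On a grid
    of at most [1 + sqrt n tau_max] radii the increments are controlled by a
    Talagrand-type inequality, at scale [sqrt(C^2 s^2 + 2 K E(s))] where the conjugate
    of [Phi] bounds [K E(s)] by [s^2 + r0^2]; monotonicity of [E_n] fills the gaps of
    the grid, and Young's inequality for [G] turns the bound into a bound on
    [|tau(fhat) - s0|].

    The concentration inequality is two-sided, one-sided in the class, and holds for
    independent variables that need not be identically distributed.  It is obtained
    by the entropy method on a finite product space, and transferred to the general
    case by rounding finitely many functions to finitely many values and by passing
    to a countable supremum.  In one coordinate, with [Z] the maximum, [Z_k] the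
    maximum without the coordinate and [tau] the maximizer, an independent copy of
    the coordinate yields [E_k (Z - Z_k)^2 <= 18 b E_k g_tau(X_k) + 3 E_k v_k(tau)],
    with [v_k] the variance; the first terms sum to [b Z] and the second ones to the
    weak variance. *)
Require Import Defs.
From HB Require Import structures.
From mathcomp Require Import all_boot all_order all_algebra.
From mathcomp Require Import all_classical all_reals all_analysis.
From mathcomp Require Import measurable_realfun.
From mathcomp Require Import ring lra.

Set Implicit Arguments.
Unset Strict Implicit.
Unset Printing Implicit Defensive.

Import Order.TTheory GRing.Theory Num.Theory.
Import numFieldNormedType.Exports.

Local Open Scope classical_set_scope.
Local Open Scope ring_scope.

(** * Expectations over a finite type *)

Section FiniteExpectation.
Context (R : realType) (Y : finType).
Implicit Types (w f g : Y -> R).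

Definition fexp w f : R := \sum_y w y * f y.

Definition weights w : Prop := (forall y, 0 <= w y) /\ \sum_y w y = 1.

Lemma fexp_cst w c : weights w -> fexp w (fun=> c) = c.
Proof. by move=> [_ w1]; rewrite /fexp -mulr_suml w1 mul1r. Qed.

Lemma fexpD w f g : fexp w (fun y => f y + g y) = fexp w f + fexp w g.
Proof. by rewrite /fexp -big_split; apply: eq_bigr => y _; rewrite mulrDr. Qed.

Lemma fexpZ w c f : fexp w (fun y => c * f y) = c * fexp w f.
Proof. by rewrite /fexp mulr_sumr; apply: eq_bigr => y _; rewrite mulrCA. Qed.

Lemma fexpB w f g : fexp w (fun y => f y - g y) = fexp w f - fexp w g.
Proof.
rewrite -[- fexp w g]mulN1r -fexpZ -fexpD.
by congr fexp; apply/funext => y; rewrite mulN1r.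
Qed.

Lemma fexp_sum (J : finType) w (h : J -> Y -> R) :
  fexp w (fun y => \sum_j h j y) = \sum_j fexp w (h j).
Proof.
rewrite /fexp exchange_big /=; apply: eq_bigr => y _.
by rewrite mulr_sumr.
Qed.

Lemma eq_fexp w f g : f =1 g -> fexp w f = fexp w g.
Proof. by move=> /funext ->. Qed.

Lemma le_fexp w f g : (forall y, 0 <= w y) -> (forall y, f y <= g y) ->
  fexp w f <= fexp w g.
Proof. by move=> w0 fg; apply: ler_sum => y _; exact: ler_wpM2l. Qed.

Lemma fexp_ge0 w f : (forall y, 0 <= w y) -> (forall y, 0 <= f y) ->
  0 <= fexp w f.
Proof. by move=> w0 f0; apply: sumr_ge0 => y _; exact: mulr_ge0. Qed.

Lemma exists_weights_gt0 w : weights w -> exists y, 0 < w y.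
Proof.
move=> [w0 w1]; apply/not_existsP => H.
suff : \sum_y w y = 0 by rewrite w1; apply/eqP; exact: oner_neq0.
apply: big1 => y _; apply/eqP; rewrite eq_le w0 andbT leNgt; apply/negP; exact: H.
Qed.

Lemma fexp_gt0 w f : weights w -> (forall y, 0 < f y) -> 0 < fexp w f.
Proof.
move=> ww f0; have [y wy] := exists_weights_gt0 ww.
rewrite /fexp (bigD1 y) //=; apply: ltr_pwDl; first exact: mulr_gt0.
by apply: sumr_ge0 => z _; apply: mulr_ge0; [apply ww | exact: ltW].
Qed.

Lemma sqr_fexp_le w f : weights w -> fexp w f ^+ 2 <= fexp w (fun y => f y ^+ 2).
Proof.
move=> ww; set m := fexp w f.
have : 0 <= fexp w (fun y => (f y - m) ^+ 2).
  by apply: fexp_ge0 => [|y]; [apply ww | exact: sqr_ge0].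
rewrite (@eq_fexp _ _ (fun y => f y ^+ 2 - (2 * m * f y - m ^+ 2))); last first.
  by move=> y; ring.
by rewrite fexpB fexpB fexpZ fexp_cst// -/m; lra.
Qed.

End FiniteExpectation.

(** * Elementary inequalities for the exponential *)

Section ExpBounds.
Context (R : realType).
Implicit Types x : R.

Lemma expR_le_inv1B x : x < 1 -> expR x <= (1 - x)^-1.
Proof.
move=> x1; rewrite -[x]opprK expRN opprK lef_pV2 ?posrE ?expR_gt0 ?subr_gt0//.
exact: expR_ge1Dx.
Qed.

(** Below -1 the left side is at most 1. Elsewhere [exp x <= 1 / (1 - x)], and multiplying the right
    side by [1 - x] gives [1 + x^2 (1 - 2 x)], which is at least 1. *)
Lemma expR_le1Dx2 x : x <= 1 / 2 -> expR x <= 1 + x + 2 * x ^+ 2.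
Proof.
move=> x1; have [x0|x0] := leP (-1) x; last first.
  have : expR x <= 1 by rewrite expR_le1; lra.
  by nra.
apply: (le_trans (expR_le_inv1B _)); first lra.
have h : 0 < 1 - x by lra.
rewrite -[leLHS]mul1r ler_pdivrMr//.
have -> : (1 + x + 2 * x ^+ 2) * (1 - x) = 1 + x ^+ 2 * (1 - 2 * x) by ring.
by rewrite lerDl mulr_ge0 ?sqr_ge0//; lra.
Qed.

Lemma expRB1_le x : `|x| <= 1 / 2 -> `|expR x - 1| <= 2 * `|x|.
Proof.
move=> hx; have hx' : x <= 1 / 2 by exact: le_trans (ler_norm _) hx.
rewrite ler_norml; apply/andP; split.
  by have := expR_ge1Dx x; have := ler_norm (- x); rewrite normrN; have := normr_ge0 x; lra.
have := expR_le1Dx2 hx'; have := ler_norm x; rewrite -[x ^+ 2]real_normK ?num_real//.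
by move: hx; have := normr_ge0 x; set a := `|x| => ? ? ? ?; nra.
Qed.

(* Young's inequality for the pair (u ln u - u + 1, e^v - 1). *)
Lemma entropy_young (u v c x : R) :
  expR u * v <= expR u * (u - c) - expR u + expR c * expR v.
Proof.
have := expR_ge1Dx (v + c - u).
rewrite -expRD -(ler_pM2l (expR_gt0 u)) -expRD.
have -> : u + (v + c - u) = c + v by ring.
by lra.
Qed.

(** The difference between [(exp x - 1)^2] and the left side is [exp x (exp x - 1 - x) >= 0]; the
    square is then at most [(2 |x|)^2]. *)
Lemma expR_entropy_le x : `|x| <= 1 / 2 -> x * expR x - expR x + 1 <= 4 * x ^+ 2.
Proof.
move=> hx; have h1 : x * expR x - expR x + 1 <= (expR x - 1) ^+ 2.
  have := expR_ge1Dx x; have := expR_gt0 x; set e := expR x => e0 he.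
  have : 0 <= e * (e - 1 - x) by apply: mulr_ge0; lra.
  by lra.
apply: le_trans h1 _; rewrite -real_normK ?num_real// -[x ^+ 2]real_normK ?num_real//.
have := expRB1_le hx; have := normr_ge0 (expR x - 1); have := normr_ge0 x.
by set a := `|x|; set b := `|_ - _| => *; nra.
Qed.

End ExpBounds.

(** Lets an error linear in [e] vanish. The cap [e <= 1] allows [e] to serve as a convex weight. *)
Lemma le_of_slack (R : realType) (x y D : R) :
  (forall e, 0 < e <= 1 -> x <= y + D * e) -> x <= y.
Proof.
move=> H; apply/ler_addgt0Pr => e e0.
have D0 : 0 < `|D| + 1 by rewrite ltr_wpDl.
pose r := Num.min 1 (e / (`|D| + 1)).
have r0 : 0 < r by rewrite lt_min ltr01 divr_gt0.
have r1 : r <= 1 by rewrite ge_min lexx.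
have re : r * (`|D| + 1) <= e by rewrite -ler_pdivlMr// ge_min lexx orbT.
have := H r; rewrite r0 r1 => /(_ isT) /le_trans; apply.
rewrite lerD2l; apply: le_trans re; rewrite mulrC.
apply: ler_wpM2l; first exact: ltW.
by have := ler_norm D; lra.
Qed.

(** * Entropy in one coordinate *)

(* One coordinate [a] of the sample is random and the others are frozen: [s i]
   is the contribution of the frozen coordinates to the i-th sum, [h i a] that
   of the random one, [t a] the maximizer, [m] the maximizer of the sums with
   the random coordinate deleted. *)
Section OneCoordinate.
Context (R : realType) (A I : finType) (w : A -> R) (s : I -> R)
  (h : I -> A -> R) (t : A -> I) (m : I) (b : R).
Hypotheses (ww : weights w) (h0 : forall i, fexp w (h i) = 0)
  (hb : forall i a, `|h i a| <= b) (hm : forall i, s i <= s m)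
  (ht : forall i a, s i + h i a <= s (t a) + h (t a) a).

Let w0 a : 0 <= w a. Proof. by have [] := ww. Qed.
Let Z a := s (t a) + h (t a) a.
Let y a := Z a - s m.
Let d a := s m - s (t a).
Let l a := h (t a) a.
(** An independent copy [a'] selects the maximizer, while the contribution is evaluated at [a]. This
    decoupling makes [hbar] centered, unlike [l]. *)
Let hbar a := fexp w (fun a' => h (t a') a).
Let vt := fexp w (fun a => fexp w (fun a' => h (t a) a' ^+ 2)).

Let b_ge0 : 0 <= b.
Proof. by have [a _] := exists_weights_gt0 ww; apply: le_trans (hb m a). Qed.

Let y_le a : `|y a| <= b.
Proof.
have := ht m a; have := hm (t a).
have := hb m a; have := hb (t a) a; rewrite /y /Z !ler_norml => /andP[? ?] /andP[? ?] ? ?.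
by apply/andP; split; lra.
Qed.

Let d_ge0 a : 0 <= d a. Proof. by rewrite subr_ge0. Qed.

Let d_le a : d a <= 2 * b.
Proof.
have := ht m a; have := hb m a; have := hb (t a) a.
by rewrite /d !ler_norml => /andP[? ?] /andP[? ?] ?; lra.
Qed.

Let lE a : l a = y a + d a. Proof. by rewrite /l /y /d /Z; ring. Qed.

Let exp_hbar : fexp w hbar = 0.
Proof.
rewrite /hbar /fexp (eq_bigr (fun a => \sum_a' w a' * (w a * h (t a') a))); last first.
  by move=> a _; rewrite mulr_sumr; apply: eq_bigr => a' _; rewrite mulrCA.
rewrite exchange_big big1// => a' _; rewrite -mulr_sumr.
by have := h0 (t a'); rewrite /fexp => ->; rewrite mulr0.
Qed.

(** Jensen's inequality in the independent copy, followed by an exchange of the two copies. *)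
Let exp_sqr_hbar : fexp w (fun a => hbar a ^+ 2) <= vt.
Proof.
apply: (@le_trans _ _ (fexp w (fun a => fexp w (fun a' => h (t a') a ^+ 2)))).
  by apply: le_fexp => // a; exact: sqr_fexp_le.
rewrite le_eqVlt; apply/orP; left; apply/eqP; rewrite /vt /fexp.
under eq_bigr do rewrite mulr_sumr.
rewrite exchange_big; apply: eq_bigr => a _; rewrite mulr_sumr.
by apply: eq_bigr => a' _; rewrite mulrCA.
Qed.

Let hbar_le a : `|hbar a| <= b.
Proof.
rewrite ler_norml; apply/andP; split.
- rewrite -(fexp_cst (- b) ww); apply: le_fexp => // a'.
  by have := hb (t a') a; rewrite ler_norml => /andP[].
- rewrite -(fexp_cst b ww); apply: le_fexp => // a'.
  by have := hb (t a') a; rewrite ler_norml => /andP[].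
Qed.

Let exp_y_ge0 : 0 <= fexp w y.
Proof.
rewrite -(h0 m); apply: le_fexp => // a.
by have := ht m a; rewrite /y /Z; lra.
Qed.

Let exp_l : fexp w l = fexp w y + fexp w d.
Proof. by rewrite -fexpD; apply: eq_fexp => a; exact: lE. Qed.

Let exp_d_ge0 : 0 <= fexp w d. Proof. exact: fexp_ge0. Qed.

(* Averaging the maximality of [t a] over an independent copy of the random
   coordinate bounds [y] from below by the centered variable [hbar - E d]. *)
Let y_lower a : 0 <= y a + fexp w d - hbar a.
Proof.
suff : fexp w (fun a' => s (t a') + h (t a') a) <= Z a.
  by rewrite fexpD fexpB fexp_cst// -/(hbar a) /y; lra.
by rewrite -(fexp_cst (Z a) ww); apply: le_fexp.
Qed.

(** Split [y] as [(y + Ed - hbar) - Ed + hbar]. The first term lies in [[0, 4 b]] and has mean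
    [E l], so its second moment is at most [4 b E l]. Next, [Ed^2 <= E d^2 <= 2 b E d <= 2 b E l],
    and [hbar] has second moment at most [vt]. The square of a sum of three terms costs a factor
    3. *)
Let exp_sqr_y : fexp w (fun a => y a ^+ 2) <= 18 * b * fexp w l + 3 * vt.
Proof.
set Ed := fexp w d.
have h1 : fexp w (fun a => (y a + Ed - hbar a) ^+ 2) <= 4 * b * fexp w l.
  apply: (@le_trans _ _ (fexp w (fun a => 4 * b * (y a + Ed - hbar a)))).
    apply: le_fexp => // a; have := y_lower a; rewrite -/Ed => y0.
    rewrite expr2 ler_wpM2r//.
    have : Ed <= 2 * b by rewrite -(fexp_cst (2 * b) ww); apply: le_fexp.
    have := y_le a; have := hbar_le a.
    by rewrite !ler_norml => /andP[? ?] /andP[? ?] ?; lra.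
  by rewrite fexpZ fexpB fexpD fexp_cst// exp_hbar exp_l subr0.
have h2 : Ed ^+ 2 <= 2 * b * fexp w l.
  apply: (le_trans (sqr_fexp_le _ ww)).
  apply: (@le_trans _ _ (fexp w (fun a => 2 * b * d a))).
    by apply: le_fexp => // a; rewrite expr2 ler_wpM2r.
  rewrite fexpZ exp_l; apply: ler_wpM2l; first exact: mulr_ge0.
  by rewrite lerDr.
apply: (@le_trans _ _ (fexp w (fun a =>
    3 * ((y a + Ed - hbar a) ^+ 2) + (3 * Ed ^+ 2 + 3 * hbar a ^+ 2)))).
  apply: le_fexp => // a.
  have := sqr_ge0 (y a + Ed - hbar a + Ed); have := sqr_ge0 (y a + Ed - hbar a - hbar a).
  by have := sqr_ge0 (Ed + hbar a); lra.
by rewrite !fexpD !fexpZ fexp_cst//; have := exp_sqr_hbar; lra.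
Qed.

Let exp_sqr_l : fexp w (fun a => l a ^+ 2) <= 40 * b * fexp w l + 6 * vt.
Proof.
have h2 : fexp w (fun a => d a ^+ 2) <= 2 * b * fexp w l.
  apply: (@le_trans _ _ (fexp w (fun a => 2 * b * d a))).
    by apply: le_fexp => // a; rewrite expr2 ler_wpM2r.
  rewrite fexpZ exp_l; apply: ler_wpM2l; first exact: mulr_ge0.
  by rewrite lerDr.
apply: (@le_trans _ _ (fexp w (fun a => 2 * y a ^+ 2 + 2 * d a ^+ 2))).
  by apply: le_fexp => // a; rewrite lE; have := sqr_ge0 (y a - d a); lra.
by rewrite fexpD !fexpZ; have := exp_sqr_y; lra.
Qed.

(** With [c = exp (z s_m)] the integrand is [c] times the entropy function at [z y], hence at most
    [4 c z^2 y^2], and [exp_sqr_y] applies. This leaves the plain means [L] and [V], which are then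
    compared with means weighted by [exp (z Z)]. The smallness of [|z| b] makes that comparison
    possible. *)
Lemma one_coordinate_entropy (z : R) : `|z| * b <= 1 / 116 ->
  fexp w (fun a => expR (z * Z a) * (z * Z a - z * s m) - expR (z * Z a) + expR (z * s m))
  <= 168 * z ^+ 2 * (b * fexp w (fun a => expR (z * Z a) * l a)
        + fexp w (fun a => expR (z * Z a) * fexp w (fun a' => h (t a) a' ^+ 2))).
Proof.
move=> zb; set c := expR (z * s m); have c0 : 0 < c by exact: expR_gt0.
have zy a : `|z * y a| <= 1 / 116.
  by rewrite normrM; apply: le_trans zb; rewrite ler_wpM2l.
have zy2 a : `|z * y a| <= 1 / 2 by apply: le_trans (zy a) _; lra.
have fE a : expR (z * Z a) = c * expR (z * y a).
  by rewrite /c -expRD; congr expR; rewrite /y; ring.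
set L := fexp w l; set V := vt.
have V0 : 0 <= V by apply: fexp_ge0 => // a; apply: fexp_ge0 => // a'; exact: sqr_ge0.
have L0 : 0 <= L by rewrite /L exp_l addr_ge0.
have h1 : fexp w (fun a => expR (z * Z a) * (z * Z a - z * s m) - expR (z * Z a) + c)
   <= c * (4 * z ^+ 2 * (18 * b * L + 3 * V)).
  apply: (@le_trans _ _ (fexp w (fun a => c * (4 * z ^+ 2 * y a ^+ 2)))).
    apply: le_fexp => // a; rewrite fE.
    have -> : c * expR (z * y a) * (z * Z a - z * s m) - c * expR (z * y a) + c
        = c * ((z * y a) * expR (z * y a) - expR (z * y a) + 1) by rewrite /y; ring.
    rewrite ler_pM2l//; apply: le_trans (expR_entropy_le (zy2 a)) _.
    by rewrite exprMn; lra.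
  rewrite fexpZ fexpZ ler_pM2l// ler_wpM2l//.
  by apply: mulr_ge0 => //; exact: sqr_ge0.
set B := fexp w (fun a => expR (z * Z a) * l a).
(* Changing the weight costs [|(exp (z y) - 1) l| <= 2 |z y l| <= |z| (l^2 + y^2)]; the constants
   are 58 = 40 + 18 and 9 = 6 + 3. *)
have h2 : c * L <= B + c * (`|z| * (58 * b * L + 9 * V)).
  apply: (@le_trans _ _ (B + c * (`|z| *
    (fexp w (fun a => l a ^+ 2) + fexp w (fun a => y a ^+ 2))))); last first.
    rewrite lerD2l ler_pM2l// ler_wpM2l//.
    by have := exp_sqr_y; have := exp_sqr_l; rewrite -/L -/V; lra.
  rewrite /L /B -fexpD -!fexpZ -fexpD; apply: le_fexp => // a.
  rewrite fE -mulrA -mulrDr ler_pM2l//.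
  suff : `|(expR (z * y a) - 1) * l a| <= `|z| * (l a ^+ 2 + y a ^+ 2).
    by rewrite ler_norml => /andP[]; lra.
  rewrite normrM; apply: (@le_trans _ _ (2 * `|z * y a| * `|l a|)).
    by apply: ler_wpM2r => //; exact: expRB1_le.
  rewrite normrM -(real_normK (num_real (l a))) -(real_normK (num_real (y a))).
  have := sqr_ge0 (`|l a| - `|y a|); have := normr_ge0 z.
  set p := `|z|; set q := `|l a|; set r := `|y a| => p0 qr.
  have : 0 <= p * (q - r) ^+ 2 by exact: mulr_ge0.
  by lra.
(* The weight [exp (z y)] is at least 1 - 1/116, hence at least 2/3. *)
have h3 : c * V <= 3 / 2 * fexp w (fun a => expR (z * Z a) * fexp w (fun a' => h (t a) a' ^+ 2)).
  rewrite -!fexpZ; apply: le_fexp => // a; rewrite mulrA; apply: ler_wpM2r.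
    by apply: fexp_ge0 => // a'; exact: sqr_ge0.
  rewrite fE mulrCA; apply: ler_peMr; first exact: ltW.
  have := expR_ge1Dx (z * y a); have := zy a; rewrite ler_norml => /andP[] *; lra.
apply: le_trans h1 _; rewrite -/B; move: h3; set W := fexp w _ => h3.
(* The threshold 1/116 = 1/(2 * 58) makes the [L] term on the right of [h2] at most half of the left
   side, which absorbs it. *)
have h4 : b * (c * L) <= 2 * b * B + c * V.
  have : `|z| * b * (58 * (c * L)) <= 1 / 116 * (58 * (c * L)).
    by apply: ler_wpM2r => //; rewrite !mulr_ge0// ltW.
  move=> k1.
  have k2 : c * L <= 2 * B + 18 * (`|z| * c * V) by lra.
  have : `|z| * b * (c * V) <= 1 / 116 * (c * V).
    by apply: ler_wpM2r => //; rewrite !mulr_ge0// ltW.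
  have := ler_wpM2l b_ge0 k2.
  have : 0 <= c * V by rewrite mulr_ge0// ltW.
  by lra.
have -> : c * (4 * z ^+ 2 * (18 * b * L + 3 * V)) = z ^+ 2 * (72 * (b * (c * L)) + 12 * (c * V)).
  by ring.
have -> : 168 * z ^+ 2 * (b * B + W) = z ^+ 2 * (168 * (b * B + W)) by ring.
(* The weighted mean [B] can be negative; this lower bound on [b * B] is what allows its coefficient
   to be raised to 168. *)
have bB : 0 <= 2 * b * B + c * V by apply: le_trans h4; rewrite !mulr_ge0// ltW.
have cV : 0 <= c * V by rewrite mulr_ge0// ltW.
by apply: ler_wpM2l; [exact: sqr_ge0 | lra].
Qed.

End OneCoordinate.

(** * Concentration on a finite product space *)

Section FiniteProduct.
Context (R : realType) (A : finType) (n : nat) (p : 'I_n -> A -> R).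
Hypothesis pw : forall i, weights (p i).
Implicit Types (x : {ffun 'I_n -> A}) (f : {ffun 'I_n -> A} -> R).

Definition upd x (k : 'I_n) (a : A) : {ffun 'I_n -> A} :=
  [ffun i => if i == k then a else x i].

Definition prod_weight x : R := \prod_i p i (x i).

Definition cond_exp (k : 'I_n) f x : R := fexp (p k) (fun a => f (upd x k a)).

Let ex f : R := fexp prod_weight f.

Lemma updE x k a : upd x k a k = a.
Proof. by rewrite ffunE eqxx. Qed.

Lemma upd_id x k : upd x k (x k) = x.
Proof. by apply/ffunP => i; rewrite ffunE; case: eqP => // ->. Qed.

Lemma upd_upd x k a a' : upd (upd x k a) k a' = upd x k a'.
Proof. by apply/ffunP => i; rewrite !ffunE; case: eqP. Qed.

Lemma prod_weights : weights prod_weight.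
Proof.
split=> [x|]; first by apply: prodr_ge0 => i _; apply pw.
rewrite /prod_weight -(bigA_distr_bigA p) /=.
by apply: big1 => i _; apply pw.
Qed.

Lemma prod_weight_upd x k a :
  prod_weight (upd x k a) * p k (x k) = prod_weight x * p k a.
Proof.
rewrite /prod_weight (bigD1 k) //= [in RHS](bigD1 k) //= updE.
rewrite (eq_bigr (fun i => p i (x i))); first ring.
by move=> i /negbTE ik; rewrite ffunE ik.
Qed.

(** Exchanging coordinate [k] of [x] with the fresh value [a] is an involution that preserves the
    joint weight of the pair [(x, a)]. *)
Lemma exp_cond_exp k f : ex (cond_exp k f) = ex f.
Proof.
pose J (xa : {ffun 'I_n -> A} * A) := (upd xa.1 k xa.2, xa.1 k).
have JK : involutive J.
  by case=> x a; rewrite /J /= upd_upd upd_id updE.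
transitivity (\sum_xa prod_weight xa.1 * (p k xa.2 * f (upd xa.1 k xa.2))).
  rewrite -(pair_bigA _ (fun x a => prod_weight x * (p k a * f (upd x k a)))).
  by apply: eq_bigr => x _; rewrite mulr_sumr.
rewrite (reindex_inj (inv_inj JK)) /=.
transitivity (\sum_xa prod_weight xa.1 * (p k xa.2 * f xa.1)).
  apply: eq_bigr => -[x a] _ /=; rewrite upd_upd upd_id.
  by rewrite mulrA prod_weight_upd mulrA.
rewrite -(pair_bigA _ (fun x a => prod_weight x * (p k a * f x))).
apply: eq_bigr => x _; rewrite -mulr_sumr -mulr_suml.
by have [_ ->] := pw k; rewrite mul1r.
Qed.

(* [partial_exp f j] averages over the coordinates below [j]. *)
Fixpoint partial_exp f (j : nat) : {ffun 'I_n -> A} -> R :=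
  if j is j'.+1 then
    if insub j' is Some k then cond_exp k (partial_exp f j')
    else partial_exp f j'
  else f.

Lemma partial_expS f (k : 'I_n) : partial_exp f k.+1 = cond_exp k (partial_exp f k).
Proof. by rewrite /= valK. Qed.

Lemma partial_exp_indep f j x x' :
  (forall i : 'I_n, (j <= i)%N -> x i = x' i) -> partial_exp f j x = partial_exp f j x'.
Proof.
elim: j x x' => [|j IH] x x' xx' /=.
  by have -> : x = x' by apply/ffunP => i; exact: xx'.
case: insubP => [k _ kj|]; last first.
  rewrite -leqNgt => nj; apply: IH => i ji.
  by have := leq_ltn_trans ji (ltn_ord i); rewrite ltnNge nj.
apply: eq_fexp => a; apply: IH => i ji; rewrite !ffunE.
case: eqP => // /eqP ik; apply: xx'; rewrite ltn_neqAle ji andbT.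
by rewrite -kj eq_sym; apply: contra ik => /eqP/val_inj ->.
Qed.

Lemma exp_partial_exp f j : ex (partial_exp f j) = ex f.
Proof.
elim: j => [//|j IH] /=; case: insubP => [k _ _|_]; last exact: IH.
by rewrite exp_cond_exp.
Qed.

Lemma partial_exp_full f x : partial_exp f n x = ex f.
Proof.
rewrite -(exp_partial_exp f n) -[LHS](fexp_cst _ prod_weights).
apply: eq_fexp => x'; apply: partial_exp_indep => i.
by rewrite leqNgt ltn_ord.
Qed.

Lemma partial_exp_gt0 f j x : (forall x, 0 < f x) -> 0 < partial_exp f j x.
Proof.
move=> f0; elim: j x => [//|j IH] x /=; case: insubP => [k _ _|//].
by apply: fexp_gt0.
Qed.

(** The logarithm of [exp u] divided by its mean telescopes along the partial averages into
    increments [v k]. Young's inequality with [c = uk k] bounds each term, and the remaining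
    exponential moment of [v k] is computed exactly. *)
Lemma entropy_tensorization (u : {ffun 'I_n -> A} -> R)
    (uk : 'I_n -> {ffun 'I_n -> A} -> R) :
  (forall k x a, uk k (upd x k a) = uk k x) ->
  ex (fun x => expR (u x) * u x) -
    ex (fun x => expR (u x)) * ln (ex (fun x => expR (u x))) <=
  \sum_k ex (fun x => expR (u x) * (u x - uk k x) - expR (u x) + expR (uk k x)).
Proof.
move=> uk_indep; pose f x := expR (u x); set F := ex (fun x => expR (u x)).
have f0 x : 0 < f x by exact: expR_gt0.
have P0 j x : 0 < partial_exp f j x by exact: partial_exp_gt0.
pose v (j : nat) x := ln (partial_exp f j x) - ln (partial_exp f j.+1 x).
have -> : ex (fun x => f x * u x) - F * ln F = \sum_(k < n) ex (fun x => f x * v k x).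
  rewrite -fexp_sum (@eq_fexp _ _ _ _ (fun x => f x * (u x - ln F))); last first.
    move=> x; rewrite -mulr_sumr; congr (_ * _).
    rewrite -(big_mkord xpredT (fun j => v j x)).
    have /= := @telescope_sumr _ 0 n (fun j => - ln (partial_exp f j x)) isT.
    rewrite partial_exp_full opprK => h.
    rewrite (eq_bigr (fun j => - ln (partial_exp f j.+1 x) - - ln (partial_exp f j x))).
      by rewrite h expRK addrC.
    by move=> j _; rewrite /v opprK addrC.
  rewrite (@eq_fexp _ _ _ _ (fun x => f x * u x - ln F * f x)); last first.
    by move=> x; ring.
  by rewrite fexpB fexpZ mulrC.
apply: ler_sum => k _.
(* Averaging coordinate [k] turns [partial_exp f k] into [partial_exp f k.+1], which does not depend
   on that coordinate; so [exp (v k)] has conditional mean 1, and [uk k] is constant in that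
   coordinate. *)
have key : ex (fun x => expR (uk k x) * expR (v k x)) = ex (fun x => expR (uk k x)).
  rewrite -[LHS](exp_cond_exp k); apply: eq_fexp => x; rewrite /cond_exp.
  rewrite (@eq_fexp _ _ _ _ (fun a =>
    (expR (uk k x) / partial_exp f k.+1 x) * partial_exp f k (upd x k a))).
    rewrite fexpZ -[fexp _ _]/(cond_exp k (partial_exp f k) x) -partial_expS.
    by rewrite -mulrA mulVf ?mulr1// gt_eqF.
  move=> a; rewrite uk_indep /v expRB !lnK ?posrE//.
  rewrite (@partial_exp_indep f k.+1 (upd x k a) x) ?mulrA.
    by rewrite -!mulrA; congr (_ * _); rewrite mulrC.
  by move=> i ki; rewrite ffunE; case: eqP => // ik; rewrite ik ltnn in ki.
rewrite /ex fexpD in key *; rewrite -key -fexpD.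
apply: le_fexp => [x|x]; first by apply prod_weights.
exact: entropy_young.
Qed.

End FiniteProduct.

(** * Entropy of the maximum of finitely many independent sums *)

Section Concentration.
Context (R : realType) (A I : finType) (n : nat) (p : 'I_n -> A -> R)
  (g : I -> 'I_n -> A -> R) (t : {ffun 'I_n -> A} -> I) (b v : R).
Hypotheses (pw : forall i, weights (p i))
  (g0 : forall j i, fexp (p i) (g j i) = 0)
  (gb : forall j i a, `|g j i a| <= b)
  (gv : forall j, \sum_i fexp (p i) (fun a => g j i a ^+ 2) <= v).
Let S j (x : {ffun 'I_n -> A}) := \sum_i g j i (x i).
Hypothesis tmax : forall j x, S j x <= S (t x) x.
Let Z x := S (t x) x.
Let ex f := fexp (prod_weight p) f.

Let Sk j k x := \sum_(i | i != k) g j i (x i).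

Let S_upd j k x a : S j (upd x k a) = Sk j k x + g j k a.
Proof.
rewrite /S (bigD1 k) //= updE addrC; congr (_ + _).
by apply: eq_bigr => i /negbTE ik; rewrite ffunE ik.
Qed.

Let Sk_upd j k x a : Sk j k (upd x k a) = Sk j k x.
Proof. by apply: eq_bigr => i /negbTE ik; rewrite ffunE ik. Qed.

(** Tensorization is used with [uk k] equal to [z] times the maximum of the sums without coordinate
    [k], and [one_coordinate_entropy] bounds each term conditionally on the other coordinates.
    Summed over [k], the contributions of the maximizer add up to [Z] and the variances to at most
    [v]. *)
Lemma entropy_max_sum (z : R) : `|z| * b <= 1 / 116 ->
  ex (fun x => expR (z * Z x) * (z * Z x)) -
    ex (fun x => expR (z * Z x)) * ln (ex (fun x => expR (z * Z x))) <=
  168 * z ^+ 2 * (b * ex (fun x => expR (z * Z x) * Z x)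
    + v * ex (fun x => expR (z * Z x))).
Proof.
move=> zb; have [x0 _] := exists_weights_gt0 (prod_weights pw).
pose mk k x := [arg max_(j > t x0) Sk j k x]%O.
have mkP k x j : Sk j k x <= Sk (mk k x) k x.
  by rewrite /mk; case: Order.TotalTheory.arg_maxP => // i _; exact.
pose Zk k x := Sk (mk k x) k x.
have Zk_upd k x a : Zk k (upd x k a) = Zk k x.
  by apply/eqP; rewrite eq_le /Zk {1}Sk_upd mkP -{1}(Sk_upd _ _ x a) mkP.
apply: (le_trans (@entropy_tensorization _ _ _ _ pw (fun x => z * Z x) (fun k x => z * Zk k x) _)).
  by move=> k x a; rewrite Zk_upd.
pose vt k x := fexp (p k) (fun a => g (t x) k a ^+ 2).
apply: (@le_trans _ _ (\sum_k (168 * z ^+ 2 *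
  (b * ex (fun x => expR (z * Z x) * g (t x) k (x k)) +
   ex (fun x => expR (z * Z x) * vt k x))))).
  apply: ler_sum => k _; rewrite -[leLHS](exp_cond_exp pw k) -fexpZ -fexpD -fexpZ.
  rewrite -[leRHS](exp_cond_exp pw k); apply: le_fexp => [x|x]; first by apply (prod_weights pw).
  rewrite /cond_exp.
  have := @one_coordinate_entropy R A I (p k) (fun j => Sk j k x)
    (fun j a => g j k a) (fun a => t (upd x k a)) (mk k x) b (pw k)
    (fun j => g0 j k) (fun j => gb j k) (fun j => mkP k x j) _ z zb.
  rewrite -fexpZ -fexpD -fexpZ => h.
  have {}h := h (fun i a => _).
  under eq_fexp do rewrite Zk_upd.
  under [leRHS]eq_fexp do rewrite /Z S_upd updE /vt.
  under eq_fexp do rewrite /Z S_upd.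
  by apply: h => i a; rewrite -!S_upd; exact: tmax.
rewrite -mulr_sumr big_split /= -mulr_sumr -!fexp_sum.
apply: ler_wpM2l; first by rewrite mulr_ge0// sqr_ge0.
apply: lerD.
  rewrite le_eqVlt; apply/orP; left; apply/eqP; congr (_ * _).
  by apply: eq_fexp => x; rewrite -mulr_sumr.
rewrite -fexpZ; apply: le_fexp => [x|x]; first by apply (prod_weights pw).
rewrite -mulr_sumr mulrC; apply: ler_wpM2r; first exact: expR_ge0.
exact: gv.
Qed.

End Concentration.

(** * From entropy to the logarithmic moment generating function (Herbst's argument) *)

Section Herbst.
Context (R : realType) (Y : finType) (w U : Y -> R) (k a t0 : R).
Hypothesis (ww : weights w).
Let F (t : R) : R := fexp w (fun y => expR (t * U y)).
Let F' (t : R) : R := fexp w (fun y => expR (t * U y) * U y).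
Hypothesis (ent : forall t : R, 0 < t <= t0 ->
  fexp w (fun y => expR (t * U y) * (t * U y)) - F t * ln (F t) <= t ^+ 2 * (k * F' t + a * F t)).

Let F_gt0 t : 0 < F t.
Proof. by apply: fexp_gt0 => // y; exact: expR_gt0. Qed.

Let is_derive_F (t : R) : is_derive t 1 F (F' t).
Proof.
rewrite /F /F' /fexp.
elim: (index_enum Y) => [|y r IH].
  under eq_fun do rewrite big_nil.
  by rewrite big_nil; exact: is_derive_cst.
under eq_fun do rewrite big_cons.
rewrite big_cons; apply: is_deriveD.
apply: is_derive_eq.
rewrite /GRing.scale /=. ring.
Qed.

(** The derivative of [ln (F t) / t] is the entropy divided by [t^2 F t]; the hypothesis [ent],
    divided by the same quantity, says exactly that [u] has nonpositive derivative on []0, t0]]. *)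
Let u (t : R) : R := ln (F t) * t^-1 - k * ln (F t) - a * t.

Let is_derive_u (t : R) : 0 < t ->
  is_derive t 1 u ((t * F' t / F t - ln (F t)) / t ^+ 2 - k * (F' t / F t) - a).
Proof.
move=> tgt0.
have h : is_derive t 1 (fun t => ln (F t)) (F' t / F t).
  apply: is_derive_eq; first exact: (is_derive1_comp (is_derive1_ln (F_gt0 t)) (is_derive_F t)).
  by rewrite mulrC.
have h2 : is_derive t 1 (fun t => t^-1) (- t ^- 2).
  apply: is_derive_eq; first by apply: is_deriveV; rewrite gt_eqF.
  by rewrite /GRing.scale /= mulr1.
rewrite /u; apply: is_derive_eq.
rewrite /GRing.scale /=; field.
by rewrite (gt_eqF tgt0) gt_eqF.
Qed.

Let u_nonincreasing (r t : R) : 0 < r -> r <= t -> t <= t0 -> u t <= u r.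
Proof.
move=> r0 rt tt0.
have du x : x \in `]r, t[ ->
    is_derive x 1 u ((x * F' x / F x - ln (F x)) / x ^+ 2 - k * (F' x / F x) - a).
  by rewrite in_itv /= => /andP[rx _]; apply: is_derive_u; exact: lt_trans rx.
have cu : {within `[r, t], continuous u}.
  apply: derivable_within_continuous => x; rewrite in_itv /= => /andP[rx _].
  by have [] := is_derive_u (lt_le_trans r0 rx).
apply: (@ler0_derive1_le_cc _ u r t) => //; rewrite ?bound_itvE//.
- by move=> x /du[].
- move=> x xrt; rewrite derive1E; have [_ ->] := du x xrt.
  move: xrt; rewrite in_itv /= => /andP[rx xt].
  have x0 : 0 < x by exact: lt_trans rx.
  have := ent (t := x); rewrite x0 (le_trans (ltW xt))// => /(_ isT).
  rewrite (@eq_fexp _ _ _ _ (fun y => x * (expR (x * U y) * U y))); last by move=> y; ring.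
  rewrite fexpZ -/(F' x) => h.
  have Fx := F_gt0 x.
  have -> : (x * F' x / F x - ln (F x)) / x ^+ 2 - k * (F' x / F x) - a
     = (x * F' x - F x * ln (F x) - x ^+ 2 * (k * F' x + a * F x)) / (x ^+ 2 * F x).
    by field; rewrite !gt_eqF.
  rewrite pmulr_lle0 ?invr_gt0 ?mulr_gt0 ?exprn_gt0//.
  by rewrite subr_le0.
Qed.

(** Since [u] is nonincreasing, [u t] is at most [u r] for small [r], and [u r] exceeds the mean of
    [U] by an arbitrarily small amount. *)
Lemma herbst (t : R) : 0 < t <= t0 ->
  ln (F t) * (1 - k * t) <= t * fexp w U + a * t ^+ 2.
Proof.
move=> /andP[tgt0 tt0].
pose M := \sum_y `|U y|.
have UM y : `|U y| <= M by rewrite /M (bigD1 y) //= lerDl sumr_ge0.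
have M0 : 0 <= M by apply: sumr_ge0.
suff : u t <= fexp w U.
  rewrite /u -(ler_pM2l tgt0).
  have -> : t * (ln (F t) * t^-1 - k * ln (F t) - a * t) = ln (F t) * (1 - k * t) - a * t ^+ 2.
    by field; rewrite gt_eqF.
  by lra.
apply/ler_addgt0Pr => e e0.
(* [D r] collects the errors [2 r M^2], [|k| M r] and [|a| r] at the small radius [r]. The bound on
   [r] by [1 / (2 (M + 1))] keeps [|r U|] below 1/2, so the quadratic bound of the exponential
   applies. *)
pose D := 2 * M ^+ 2 + `|k| * M + `|a| + 1.
have D0 : 0 < D by rewrite /D ltr_wpDl// !addr_ge0// ?mulr_ge0// sqr_ge0.
pose r := Num.min t (Num.min (e / D) (1 / 2 / (M + 1))).
have r0 : 0 < r by rewrite /r !lt_min tgt0 !divr_gt0//; lra.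
have rt : r <= t by rewrite /r ge_min lexx.
have re : r * D <= e by rewrite -ler_pdivlMr// /r !ge_min lexx orbT.
have rM : r * (M + 1) <= 1 / 2 by rewrite -ler_pdivlMr ?/r ?ge_min ?lexx ?orbT//; lra.
apply: (le_trans (u_nonincreasing r0 rt tt0)).
have rU y : `|r * U y| <= 1 / 2.
  rewrite normrM gtr0_norm//; apply: le_trans rM; apply: ler_wpM2l; first exact: ltW.
  by have := UM y; lra.
have lnF_le : ln (F r) <= r * fexp w U + 2 * r ^+ 2 * M ^+ 2.
  have : ln (F r) <= F r - 1.
    have := @le_ln1Dx _ (F r - 1); have -> : 1 + (F r - 1) = F r by ring.
    by apply; have := F_gt0 r; lra.
  move=> /le_trans; apply; rewrite lerBlDr.
  have <- : fexp w (fun y => r * U y + 2 * r ^+ 2 * M ^+ 2 + 1) =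
      r * fexp w U + 2 * r ^+ 2 * M ^+ 2 + 1.
    by rewrite fexpD fexpD fexpZ !fexp_cst.
  apply: le_fexp => [y|y]; first by apply ww.
  apply: (le_trans (expR_le1Dx2 (le_trans (ler_norm _) (rU y)))).
  have : U y ^+ 2 <= M ^+ 2 by rewrite -real_normK ?num_real// lerXn2r ?nnegrE.
  move=> /(ler_wpM2l (sqr_ge0 r)); rewrite exprMn; lra.
have lnF_ge : - k * ln (F r) <= r * (`|k| * M).
  apply: (le_trans (ler_norm _)); rewrite normrM normrN mulrCA.
  apply: ler_wpM2l => //; rewrite ler_norml; apply/andP; split.
    rewrite -[leLHS]expRK ler_ln ?posrE ?expR_gt0//.
    rewrite -(fexp_cst (expR _) ww); apply: le_fexp => [y|y]; first by apply ww.
    rewrite ler_expR -mulrN ler_pM2l//.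
    by have := UM y; rewrite ler_norml => /andP[].
  rewrite -[leRHS]expRK ler_ln ?posrE ?expR_gt0//.
  rewrite -(fexp_cst (expR _) ww); apply: le_fexp => [y|y]; first by apply ww.
  rewrite ler_expR ler_pM2l//.
  by have := UM y; rewrite ler_norml => /andP[].
have : ln (F r) * r^-1 <= fexp w U + 2 * r * M ^+ 2.
  by rewrite ler_pdivrMr//; lra.
have : - a * r <= `|a| * r by rewrite ler_pM2r// -normrN ler_norm.
by rewrite /u /D in re *; lra.
Qed.

End Herbst.

(** * Moment generating function of the maximum, for both signs of the parameter *)

Section Concentration.
Context (R : realType) (A I : finType) (n : nat) (p : 'I_n -> A -> R)
  (g : I -> 'I_n -> A -> R) (t : {ffun 'I_n -> A} -> I) (b v : R).
Hypotheses (pw : forall i, weights (p i))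
  (g0 : forall j i, fexp (p i) (g j i) = 0)
  (gb : forall j i a, `|g j i a| <= b)
  (gv : forall j, \sum_i fexp (p i) (fun a => g j i a ^+ 2) <= v).
Let S j (x : {ffun 'I_n -> A}) := \sum_i g j i (x i).
Hypothesis tmax : forall j x, S j x <= S (t x) x.
Let Z x := S (t x) x.
Let ex f := fexp (prod_weight p) f.

Lemma fexp_prod_coord i (f : A -> R) : ex (fun x => f (x i)) = fexp (p i) f.
Proof.
rewrite -[LHS](exp_cond_exp pw i) -[RHS](fexp_cst _ (prod_weights pw)).
by apply: eq_fexp => x; apply: eq_fexp => a; rewrite updE.
Qed.

Lemma fexp_max_sum_ge0 : 0 <= ex Z.
Proof.
have [x0 _] := exists_weights_gt0 (prod_weights pw).
apply: (@le_trans _ _ (ex (S (t x0)))).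
  rewrite /ex /S fexp_sum big1// => i _.
  by rewrite -[LHS]/(ex (fun x => g (t x0) i (x i))) fexp_prod_coord.
by apply: le_fexp => // x; apply (prod_weights pw).
Qed.

(** Herbst's argument is run for [sg * Z] at [|z|], which treats both tails at once. It bounds
    [H (1 - 168 b z)]; the condition on [z] gives [|168 b z| <= 1/2], so dividing by this factor at
    most doubles 168 and adds a term in [b * ex Z], where [ex Z >= 0]. *)
Lemma mgf_max_sum (b_ge0 : 0 <= b) (z : R) : 336 * `|z| * b <= 1 ->
  ex (fun x => expR (z * Z x)) <= expR (z * ex Z + 336 * z ^+ 2 * (v + b * ex Z)).
Proof.
move=> zb; have EZ0 := fexp_max_sum_ge0.
have [->|z0] := eqVneq z 0.
  rewrite !mul0r expr0n /= mulr0 mul0r add0r expR0.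
  rewrite /ex; under eq_fexp do rewrite mul0r expR0.
  by rewrite fexp_cst//; exact: prod_weights.
have az : 0 < `|z| by rewrite normr_gt0.
have F0 : 0 < ex (fun x => expR (z * Z x)).
  by apply: fexp_gt0 => [|x]; [exact: prod_weights | exact: expR_gt0].
rewrite -ler_ln ?posrE ?expR_gt0// expRK.
pose sg : R := Num.sg z.
have zE : z = `|z| * sg by rewrite mulrC -numEsg.
have sg2 : sg * sg = 1 by rewrite -expr2 sqr_sg z0.
have v0 : 0 <= v.
  have [x0 _] := exists_weights_gt0 (prod_weights pw).
  apply: le_trans (gv (t x0)); apply: sumr_ge0 => i _.
  by apply: fexp_ge0 => a; [apply pw | exact: sqr_ge0].
set H := ln _.
have h : H * (1 - 168 * b * z) <= z * ex Z + 168 * v * z ^+ 2.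
  have -> : z ^+ 2 = `|z| ^+ 2 by rewrite real_normK ?num_real.
  have -> : 1 - 168 * b * z = 1 - 168 * b * sg * `|z| by rewrite {1}zE; ring.
  have -> : z * ex Z = `|z| * fexp (prod_weight p) (fun x => sg * Z x).
    by rewrite fexpZ mulrA -zE.
  have -> : H = ln (fexp (prod_weight p) (fun x => expR (`|z| * (sg * Z x)))).
    by congr ln; apply: eq_fexp => x; rewrite mulrA -zE.
  apply: (@herbst _ _ _ _ _ _ `|z|); [exact: prod_weights | | by rewrite az lexx].
  move=> r /andP[r0 rz].
  have := @entropy_max_sum R A I n p g t b v pw g0 gb gv tmax (r * sg).
  have rs2 : (r * sg) ^+ 2 = r ^+ 2 by rewrite exprMn [sg ^+ 2]expr2 sg2 mulr1.
  rewrite rs2 normrM.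
  have -> : `|sg| = 1.
    by rewrite normr_sg z0.
  rewrite mulr1 gtr0_norm// => hent.
  have {}hent := hent _.
  have E1 c f : fexp (prod_weight p) (fun x => expR (r * (sg * Z x)) * (c * f x)) =
     c * fexp (prod_weight p) (fun x => expR (r * sg * Z x) * f x).
    by rewrite -fexpZ; apply: eq_fexp => x; rewrite [r * (sg * _)]mulrA mulrCA.
  have E2 : (fun x => expR (r * (sg * Z x))) = (fun x => expR (r * sg * Z x)).
    by apply/funext => x; rewrite mulrA.
  rewrite E2 (E1 sg Z) (_ : (fun x => _ * (r * (sg * Z x))) =
     (fun x => expR (r * sg * Z x) * (r * sg * Z x))); last first.
    by apply/funext => x; rewrite !mulrA.
  apply: (le_trans (hent _)).
    have : r * b <= `|z| * b by exact: ler_wpM2r.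
    by lra.
  have -> : 168 * b * sg * (sg * fexp (prod_weight p) (fun x => expR (r * sg * Z x) * Z x))
     = 168 * b * (sg * sg) * fexp (prod_weight p) (fun x => expR (r * sg * Z x) * Z x) by ring.
  by rewrite sg2 le_eqVlt; apply/orP; left; apply/eqP; rewrite /ex /Z /S; ring.
have hz : `|168 * b * z| <= 1 / 2.
  rewrite !normrM (ger0_norm b_ge0) (gtr0_norm (_ : 0 < 168))//; lra.
have zz : z * z = `|z| * `|z| by rewrite -!expr2 real_normK ?num_real.
move: hz h; set x := 168 * b * z => /[!ler_norml] /andP[x1 x2] h.
(* The product [x * z] is nonnegative for either sign of [z], so one computation covers both
   tails. *)
have xz : x * z = 168 * b * z ^+ 2 by rewrite /x; ring.
have pos : 0 < 1 - x by lra.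
rewrite -(ler_pM2r pos); apply: (le_trans h).
have -> : z * ex Z + 336 * z ^+ 2 * (v + b * ex Z) =
    z * ex Z + 336 * v * z ^+ 2 + 2 * (x * z) * ex Z by rewrite xz; ring.
have xz0 : 0 <= x * z by rewrite xz; apply: mulr_ge0; [exact: mulr_ge0 | exact: sqr_ge0].
have vz : 0 <= v * z ^+ 2 by apply: mulr_ge0 => //; exact: sqr_ge0.
have : 0 <= (x * z) * ex Z * (1 - 2 * x) by apply: mulr_ge0; [exact: mulr_ge0 | lra].
have : 0 <= v * z ^+ 2 * (1 - 2 * x) by apply: mulr_ge0 => //; lra.
by lra.
Qed.

End Concentration.

(** * Transfer to a general sample *)

Definition bounded_mfun (R : realType) (d : measure_display) (Om : measurableType d)
    (Y : Om -> R) : Prop :=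
  measurable_fun setT Y /\ exists M, forall w, `|Y w| <= M.

Definition mean (R : realType) (d : measure_display) (Om : measurableType d)
  (P : probability Om R) (Y : Om -> R) : R := fine 'E_P[Y].

Section BoundedMeasurable.
Context (R : realType) (d : measure_display) (Om : measurableType d).
Implicit Types Y Z : Om -> R.

Lemma bounded_mfun_cst c : bounded_mfun (fun _ : Om => c : R).
Proof. by split => //; exists `|c|. Qed.

Lemma bounded_mfunD Y Z : bounded_mfun Y -> bounded_mfun Z ->
  bounded_mfun (fun w => Y w + Z w).
Proof.
move=> [mY [M YM]] [mZ [N ZN]]; split; first exact: measurable_funD.
by exists (M + N) => w; rewrite (le_trans (ler_normD _ _))// lerD.
Qed.

Lemma bounded_mfunM Y Z : bounded_mfun Y -> bounded_mfun Z ->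
  bounded_mfun (fun w => Y w * Z w).
Proof.
move=> [mY [M YM]] [mZ [N ZN]]; split; first exact: measurable_funM.
by exists (M * N) => w; rewrite normrM ler_pM.
Qed.

Lemma bounded_mfunZ c Y : bounded_mfun Y -> bounded_mfun (fun w => c * Y w).
Proof. by apply: bounded_mfunM; exact: bounded_mfun_cst. Qed.

Lemma bounded_mfunB Y Z : bounded_mfun Y -> bounded_mfun Z ->
  bounded_mfun (fun w => Y w - Z w).
Proof.
move=> bY bZ; have := bounded_mfunD bY (bounded_mfunZ (-1) bZ).
by congr bounded_mfun; apply/funext => w; rewrite mulN1r.
Qed.

Lemma bounded_mfunX k Y : bounded_mfun Y -> bounded_mfun (fun w => Y w ^+ k).
Proof.
move=> bY; elim: k => [|k IH].
  by under eq_fun do rewrite expr0; exact: bounded_mfun_cst.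
by under eq_fun do rewrite exprS; exact: bounded_mfunM.
Qed.

Lemma bounded_mfun_sum (J : finType) (Y : J -> Om -> R) :
  (forall j, bounded_mfun (Y j)) -> bounded_mfun (fun w => \sum_j Y j w).
Proof.
move=> bY; elim: (index_enum J) => [|j r IH].
  by under eq_fun do rewrite big_nil; exact: bounded_mfun_cst.
by under eq_fun do rewrite big_cons; exact: bounded_mfunD.
Qed.

Lemma bounded_mfun_expR Y : bounded_mfun Y -> bounded_mfun (fun w => expR (Y w)).
Proof.
move=> [mY [M YM]]; split; first exact: measurableT_comp.
exists (expR M) => w; rewrite ger0_norm ?expR_ge0// ler_expR.
exact: le_trans (ler_norm _) (YM w).
Qed.

Lemma bounded_mfun_comp (d' : measure_display) (T : measurableType d')
    (h : T -> R) (X : {mfun Om >-> T}) :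
  bounded_mfun h -> bounded_mfun (fun w => h (X w)).
Proof.
by move=> [mh [M hM]]; split; [exact: measurableT_comp | exists M].
Qed.

Lemma bounded_mfun_indic (A : set Om) : measurable A ->
  bounded_mfun (fun w => \1_A w : R).
Proof.
move=> mA; split; first exact: measurable_indic.
by exists 1 => w; rewrite indicE; case: (_ \in _); rewrite ?normr1 ?normr0.
Qed.

End BoundedMeasurable.

Section Mean.
Context (R : realType) (d : measure_display) (Om : measurableType d)
  (P : probability Om R).
Implicit Types Y Z : Om -> R.

Lemma probability_inhabited : exists w : Om, True.
Proof.
apply/not_existsP => H; have : P setT = 0%E.
  by rewrite (_ : setT = set0) ?measure0//; apply/seteqP; split => w // _; exact: (H w).
by rewrite probability_setT => /eqP; rewrite onee_eq0.
Qed.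

Lemma meanE Y : mean P Y = \int[P]_w Y w.
Proof. by rewrite /mean unlock. Qed.

Lemma bounded_mfun_integrable Y : bounded_mfun Y -> P.-integrable setT (EFin \o Y).
Proof.
move=> [mY [M YM]]; apply: measurable_bounded_integrable => //.
  by rewrite (le_lt_trans (probability_le1 _ _))// ltry.
exists M; split; first exact: num_real.
by move=> x Mx w _; exact: le_trans (YM w) (ltW Mx).
Qed.

Lemma EFin_mean Y : bounded_mfun Y -> (mean P Y)%:E = (\int[P]_w (Y w)%:E)%E.
Proof.
move=> bY; rewrite meanE /Rintegral fineK//.
by apply: integrable_fin_num => //; exact: bounded_mfun_integrable.
Qed.

Lemma mean_cst c : mean P (fun=> c) = c.
Proof. by rewrite /mean (expectation_cst P c). Qed.

Lemma meanD Y Z : bounded_mfun Y -> bounded_mfun Z ->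
  mean P (fun w => Y w + Z w) = mean P Y + mean P Z.
Proof. by move=> bY bZ; rewrite !meanE RintegralD//; exact: bounded_mfun_integrable. Qed.

Lemma meanB Y Z : bounded_mfun Y -> bounded_mfun Z ->
  mean P (fun w => Y w - Z w) = mean P Y - mean P Z.
Proof. by move=> bY bZ; rewrite !meanE RintegralB//; exact: bounded_mfun_integrable. Qed.

Lemma meanZ c Y : bounded_mfun Y -> mean P (fun w => c * Y w) = c * mean P Y.
Proof. by move=> bY; rewrite !meanE RintegralZl//; exact: bounded_mfun_integrable. Qed.

Lemma mean_sum (J : finType) (Y : J -> Om -> R) : (forall j, bounded_mfun (Y j)) ->
  mean P (fun w => \sum_j Y j w) = \sum_j mean P (Y j).
Proof.
move=> bY; suff : bounded_mfun (fun w => \sum_j Y j w) /\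
    mean P (fun w => \sum_j Y j w) = \sum_j mean P (Y j) by case.
elim: (index_enum J) => [|j r [IH1 IH2]].
  under eq_fun do rewrite big_nil; rewrite big_nil mean_cst.
  by split => //; exact: bounded_mfun_cst.
under eq_fun do rewrite big_cons; rewrite big_cons meanD// IH2.
by split => //; exact: bounded_mfunD.
Qed.

Lemma le_mean Y Z : bounded_mfun Y -> bounded_mfun Z -> (forall w, Y w <= Z w) ->
  mean P Y <= mean P Z.
Proof. by move=> bY bZ YZ; rewrite !meanE le_Rintegral//; exact: bounded_mfun_integrable. Qed.

Lemma mean_indic (A : set Om) : measurable A -> mean P (fun w => \1_A w) = fine (P A).
Proof. by move=> mA; rewrite /mean expectation_indic. Qed.

Lemma norm_mean_le Y M : bounded_mfun Y -> (forall w, `|Y w| <= M) -> `|mean P Y| <= M.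
Proof.
move=> bY YM; rewrite ler_norml -{1}(mean_cst (- M)) -{2}(mean_cst M).
by apply/andP; split; apply: le_mean => //; try exact: bounded_mfun_cst;
  move=> w; have := YM w; rewrite ler_norml => /andP[].
Qed.

Lemma chernoff Y : bounded_mfun Y ->
  (P [set w | 0 <= Y w]%R <= (mean P (fun w => expR (Y w)))%:E)%E.
Proof.
move=> bY; have mA : measurable [set w | 0 <= Y w].
  rewrite (_ : [set w | _] = Y @^-1` `[0, +oo[); last first.
    by apply/seteqP; split => w /=; rewrite in_itv /= andbT.
  by rewrite -[_ @^-1` _]setTI; apply bY => //; exact: measurable_itv.
have fin : P [set w | 0 <= Y w]%R \is a fin_num by exact: fin_num_measure.
rewrite -(fineK fin) lee_fin -mean_indic//; apply: le_mean.
- exact: bounded_mfun_indic.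
- exact: bounded_mfun_expR.
move=> w; rewrite indicE; case: (boolP (w \in _)) => [|_]; last by rewrite expR_ge0.
by rewrite inE /= => Yw; rewrite mulr1n; have := expR_ge1Dx (Y w); lra.
Qed.

Lemma mean_cvg (Y_ : nat -> Om -> R) Y M :
  (forall m, bounded_mfun (Y_ m)) -> (forall m w, `|Y_ m w| <= M) ->
  (forall w, Y_ ^~ w @ \oo --> Y w) ->
  bounded_mfun Y /\ (fun m => mean P (Y_ m)) @ \oo --> mean P Y.
Proof.
move=> bY YM cY.
have bYl : bounded_mfun Y.
  split; first by apply: (measurable_fun_cvg (h := Y_)) => [m|w _]; [apply bY | exact: cY].
  exists M => w; apply: (cvgr_to_le (cvg_norm (cY w))); exact: nearW.
split => //.
have := @dominated_convergence _ Om R P setT measurableT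
  (fun m w => (Y_ m w)%:E) (EFin \o Y) (fun=> M%:E).
case.
- by move=> m; apply/measurable_EFinP; apply bY.
- by apply/measurable_EFinP; apply bYl.
- by apply: aeW => w _; apply/fine_cvgP; split => /=; [near=> m | exact: cY].
- exact: finite_measure_integrable_cst.
- by apply: aeW => w m _ /=; rewrite lee_fin.
move=> _ _; rewrite /= -EFin_mean//.
under eq_fun do rewrite -EFin_mean//.
by move=> /fine_cvgP[].
Unshelve. all: end_near.
Qed.

End Mean.

(** * Variables with finitely many values and the finite quotient of the sample *)

Section FiniteRange.
Context (R : realType) (d : measure_display) (Om : measurableType d)
  (P : probability Om R) (B : finType) (Y : Om -> B) (phi : B -> R).
Hypothesis mY : forall b, measurable (Y @^-1` [set b]).

Let phi_indic : (fun w => phi (Y w)) =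
  (fun w => \sum_b phi b * \1_(Y @^-1` [set b]) w).
Proof.
apply/funext => w; rewrite (bigD1 (Y w)) //= big1 => [|b bY].
  by rewrite addr0 indicE mem_set// mulr1.
by rewrite indicE memNset ?mulr0// => /= e; rewrite e eqxx in bY.
Qed.

Lemma bounded_mfun_finite_range : bounded_mfun (fun w => phi (Y w)).
Proof.
rewrite phi_indic; apply: bounded_mfun_sum => b.
by apply: bounded_mfunZ; exact: bounded_mfun_indic.
Qed.

Lemma mean_finite_range :
  mean P (fun w => phi (Y w)) = \sum_b fine (P (Y @^-1` [set b])) * phi b.
Proof.
rewrite phi_indic mean_sum => [|b]; last first.
  by apply: bounded_mfunZ; exact: bounded_mfun_indic.
apply: eq_bigr => b _; rewrite meanZ; last exact: bounded_mfun_indic.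
by rewrite mean_indic// mulrC.
Qed.

End FiniteRange.

Section FiniteQuotient.
Context (R : realType) (d d' : measure_display) (Om : measurableType d)
  (T : measurableType d') (P : probability Om R) (n : nat)
  (X : 'I_n -> {mfun Om >-> T}) (A : finType) (rho : T -> A).
Hypothesis mrho : forall a, measurable (rho @^-1` [set a]).

Definition quotient_law (i : 'I_n) (a : A) : R :=
  fine (P (X i @^-1` (rho @^-1` [set a]))).

Definition quotient_sample (w : Om) : {ffun 'I_n -> A} := [ffun i => rho (X i w)].

Let mXrho i a : measurable (X i @^-1` (rho @^-1` [set a])).
Proof. by rewrite -[_ @^-1` _]setTI; exact: measurable_funPT. Qed.

Lemma bounded_mfun_quotient i (f : A -> R) :
  bounded_mfun (fun w => f (rho (X i w))).
Proof. exact: (bounded_mfun_finite_range f (mXrho i)). Qed.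

Lemma mean_quotient_law i (f : A -> R) :
  mean P (fun w => f (rho (X i w))) = fexp (quotient_law i) f.
Proof. exact: (mean_finite_range P f (mXrho i)). Qed.

Lemma quotient_law_weights i : weights (quotient_law i).
Proof.
split=> [a|]; first by rewrite fine_ge0.
have := mean_quotient_law i (fun=> 1); rewrite mean_cst /fexp => ->.
by apply: eq_bigr => a _; rewrite mulr1.
Qed.

Let quotient_sample_fiber x : quotient_sample @^-1` [set x] =
  \bigcap_(i in [set` [set: 'I_n]%SET]) (X i @^-1` (rho @^-1` [set x i])).
Proof.
apply/seteqP; split => w /=; first by move=> <- i _ /=; rewrite ffunE.
move=> H; apply/ffunP => i; rewrite ffunE.
by have /= := H i; rewrite finset.in_setT => /(_ isT).
Qed.

Let quotient_sample_measurable x : measurable (quotient_sample @^-1` [set x]).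
Proof.
by rewrite quotient_sample_fiber; apply: fin_bigcap_measurable => //; exact: finite_finset.
Qed.

Lemma bounded_mfun_quotient_sample (phi : {ffun 'I_n -> A} -> R) :
  bounded_mfun (fun w => phi (quotient_sample w)).
Proof. exact: bounded_mfun_finite_range. Qed.

(** A fiber of the quotient sample is an intersection of one event per coordinate, so independence
    turns its probability into the product weight. *)
Lemma mean_quotient_sample (phi : {ffun 'I_n -> A} -> R) :
  mutually_independent P X ->
  mean P (fun w => phi (quotient_sample w)) = fexp (prod_weight quotient_law) phi.
Proof.
move=> indep; rewrite mean_finite_range//; apply: eq_bigr => x _; congr (_ * _).
rewrite quotient_sample_fiber indep; last by move=> i; exact: mrho.
rewrite /prod_weight /quotient_law.
rewrite (eq_bigr (fun i => (quotient_law i (x i))%:E)); last first.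
  by move=> i _; rewrite fineK// fin_num_measure.
by rewrite prodEFin /=; apply: eq_bigl => i; rewrite inE.
Qed.

End FiniteQuotient.

(** * Simultaneous rounding of finitely many bounded functions *)

Section Rounding.
Context (R : realType) (d' : measure_display) (T : measurableType d') (I : finType)
  (h : I -> T -> R) (K e : R).
Hypotheses (mh : forall j, measurable_fun setT (h j))
  (hK : forall j x, `|h j x| <= K) (e0 : 0 < e) (K0 : 0 <= K).

(** Cut [[-K, K]] into cells of length [e]. A point is sent to the vector of the cells containing
    the values [h j x], and each function is replaced by the left end of its cell. *)
Lemma exists_rounding : exists (A : finType) (rho : T -> A) (h' : I -> A -> R),
  [/\ forall a, measurable (rho @^-1` [set a]),
      forall j a, `|h' j a| <= K &
      forall j x, `|h j x - h' j (rho x)| <= e].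
Proof.
pose N := Num.trunc (2 * K / e).
pose idx (j : I) x := Num.trunc ((h j x + K) / e).
have hKe j x : 0 <= (h j x + K) / e.
  apply: divr_ge0; last exact: ltW.
  by have := hK j x; rewrite ler_norml => /andP[]; lra.
have idx_lt j x : (idx j x < N.+1)%N.
  rewrite ltnS /idx /N; apply: Num.Theory.le_truncn.
  by rewrite ler_pM2r ?invr_gt0//; have := hK j x; rewrite ler_norml => /andP[]; lra.
have idx_itv j x : (idx j x)%:R * e - K <= h j x < (idx j x).+1%:R * e - K.
  have /andP[] := Num.Theory.truncn_itv (hKe j x).
  by rewrite -/(idx j x) ler_pdivlMr// ltr_pdivrMr// => ? ?; apply/andP; split; lra.
(* The cap at [K] gives the uniform bound at every index vector, including those that no point
   attains. *)
exists {ffun I -> 'I_N.+1}, (fun x => [ffun j => Ordinal (idx_lt j x)]),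
  (fun j (a : {ffun I -> 'I_N.+1}) => Num.min ((a j)%:R * e - K) K); split.
- move=> a.
  have -> : (fun x => [ffun j => Ordinal (idx_lt j x)]) @^-1` [set a] =
     \bigcap_(j in [set: I]) (h j @^-1` `[(a j)%:R * e - K, (a j).+1%:R * e - K[).
    apply/seteqP; split => x /=.
      by move=> <- j _ /=; rewrite in_itv /= ffunE; exact: idx_itv.
    move=> H; apply/ffunP => j; rewrite ffunE; apply/val_inj => /=.
    have := H j Logic.I; rewrite /= in_itv /= => /andP[h1 h2].
    apply: Num.Theory.truncn_def; apply/andP; split.
      by rewrite ler_pdivlMr//; lra.
    by rewrite ltr_pdivrMr//; lra.
  apply: fin_bigcap_measurable => // j _; rewrite -[_ @^-1` _]setTI.
  by apply: mh => //; exact: measurable_itv.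
- move=> j a; rewrite ler_norml; apply/andP; split; last by rewrite ge_min lexx orbT.
  rewrite le_min; apply/andP; split; last by apply: (@le_trans _ _ 0); rewrite ?oppr_le0.
  by rewrite lerDr mulr_ge0// ltW.
- move=> j x; rewrite ffunE /=; have /andP[h1 h2] := idx_itv j x.
  have := hK j x; rewrite ler_norml => /andP[_ hKx].
  rewrite min_l; last by apply: le_trans hKx.
  rewrite ger0_norm ?subr_ge0//.
  by move: h2; rewrite -natr1; lra.
Qed.

End Rounding.

Lemma le_expR_of_slack (R : realType) (M B D : R) :
  (forall e, 0 < e <= 1 -> M <= expR (B + D * e)) -> M <= expR B.
Proof.
move=> H; have [M0|M0] := leP M 0; first exact: le_trans M0 (expR_ge0 _).
rewrite -[M]lnK ?posrE// ler_expR; apply: (@le_of_slack _ _ _ D) => e /H.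
by rewrite -{1}[M]lnK ?posrE// ler_expR.
Qed.

(** * Centered sums over a general sample *)

Section EmpiricalSums.
Context (R : realType) (d d' : measure_display) (Om : measurableType d)
  (T : measurableType d') (P : probability Om R) (n : nat)
  (X : 'I_n -> {mfun Om >-> T}).

Definition centered (h : T -> R) (i : 'I_n) (w : Om) : R :=
  h (X i w) - mean P (fun w => h (X i w)).

Definition centered_sum (h : T -> R) (w : Om) : R := \sum_i centered h i w.

Definition sum_var (h : T -> R) : R := \sum_i mean P (fun w => centered h i w ^+ 2).

Lemma bounded_mfun_centered h i : bounded_mfun h -> bounded_mfun (centered h i).
Proof.
move=> bh; apply: bounded_mfunB; last exact: bounded_mfun_cst.
exact: bounded_mfun_comp.
Qed.

Lemma bounded_mfun_centered_sum h : bounded_mfun h -> bounded_mfun (centered_sum h).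
Proof. by move=> bh; apply: bounded_mfun_sum => i; exact: bounded_mfun_centered. Qed.

Lemma norm_centered_le h i w K : bounded_mfun h -> (forall x, `|h x| <= K) ->
  `|centered h i w| <= 2 * K.
Proof.
move=> bh hK; rewrite /centered (le_trans (ler_normB _ _))//.
have : `|mean P (fun w => h (X i w))| <= K.
  by apply: norm_mean_le => //; exact: bounded_mfun_comp.
by have := hK (X i w); lra.
Qed.

Lemma norm_centered_sum_le h w K : bounded_mfun h -> (forall x, `|h x| <= K) ->
  `|centered_sum h w| <= n%:R * (2 * K).
Proof.
move=> bh hK; apply: (le_trans (ler_norm_sum _ _ _)).
apply: (@le_trans _ _ (\sum_(i < n) 2 * K)).
  by apply: ler_sum => i _; exact: norm_centered_le.
by rewrite sumr_const card_ord (mulr_natl (2 * K)).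
Qed.

Lemma mean_centered_sum h : bounded_mfun h -> mean P (centered_sum h) = 0.
Proof.
move=> bh; rewrite mean_sum => [|i]; last exact: bounded_mfun_centered.
rewrite big1// => i _; rewrite /centered meanB; last exact: bounded_mfun_cst.
  by rewrite mean_cst subrr.
exact: bounded_mfun_comp.
Qed.

(** Rounding with mesh [e] reduces the claim to a finite product space, where [mgf_max_sum] applies
    with [b = 2 K]. Every error made on the way is linear in [e] and sits in the exponent, so it
    vanishes with [e]. *)
Lemma mgf_finite_max (I : finType) (h : I -> T -> R) (K v z : R) (Z : Om -> R) :
  mutually_independent P X ->
  (forall j, measurable_fun setT (h j)) -> (forall j x, `|h j x| <= K) -> 0 <= K ->
  (forall j, sum_var (h j) <= v) ->
  bounded_mfun Z -> (forall j w, centered_sum (h j) w <= Z w) ->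
  (forall w, exists j, Z w = centered_sum (h j) w) ->
  336 * `|z| * (2 * K) <= 1 ->
  mean P (fun w => expR (z * Z w)) <=
  expR (z * mean P Z + 336 * z ^+ 2 * (v + 2 * K * mean P Z)).
Proof.
move=> indep mh hK K0 hv bZ Zge Zmax zK.
have bh j : bounded_mfun (h j) by split => //; exists K.
pose nR : R := n%:R; have nR0 : 0 <= nR by exact: ler0n.
apply: (@le_expR_of_slack _ _ _
  (* The first term pays twice for replacing [Z] by [Z'], in the exponential and in the mean; the
     second pays for the changes of the variance and of the mean next to it. *)
  (4 * nR * `|z| + 336 * z ^+ 2 * (nR * (8 * K + 4) + 4 * K * nR))) => e /andP[e0 e1].
have [A [rho [h' [mrho h'K hh']]]] := exists_rounding mh hK e0 K0.
pose p := quotient_law P X rho.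
have pw i : weights (p i) by exact: quotient_law_weights.
pose g j i a := h' j a - fexp (p i) (h' j).
have mq i f : mean P (fun w => f (rho (X i w))) = fexp (p i) f by exact: mean_quotient_law.
have brho i (f : A -> R) : bounded_mfun (fun w => f (rho (X i w))).
  exact: (bounded_mfun_quotient X mrho).
have g0 j i : fexp (p i) (g j i) = 0 by rewrite fexpB fexp_cst// subrr.
have gb j i a : `|g j i a| <= 2 * K.
  rewrite (le_trans (ler_normB _ _))//.
  have : `|fexp (p i) (h' j)| <= K.
    by rewrite -mq; apply: norm_mean_le => //.
  by have := h'K j a; lra.
have gc j i w : `|g j i (rho (X i w)) - centered (h j) i w| <= 2 * e.
  rewrite /g /centered -mq.
  have : `|mean P (fun w => h j (X i w) - h' j (rho (X i w)))| <= e.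
    apply: norm_mean_le => //; apply: bounded_mfunB => //; exact: bounded_mfun_comp.
  rewrite meanB//; last exact: bounded_mfun_comp.
  have := hh' j (X i w); rewrite !ler_norml => /andP[? ?] /andP[? ?].
  by apply/andP; split; lra.
have gv j : \sum_i fexp (p i) (fun a => g j i a ^+ 2) <= v + nR * ((8 * K + 4) * e).
  have -> : nR * ((8 * K + 4) * e) = \sum_(i < n) (8 * K + 4) * e.
    by rewrite sumr_const card_ord (mulr_natl ((8 * K + 4) * e)).
  apply: (@le_trans _ _ (sum_var (h j) + \sum_(i < n) (8 * K + 4) * e)); last by rewrite lerD2r.
  rewrite -big_split; apply: ler_sum => i _ /=.
  rewrite -(mq i (fun a => g j i a ^+ 2)) -[X in _ + X](mean_cst P) -meanD; last 2 first.
  - by apply: bounded_mfunX; exact: bounded_mfun_centered.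
  - exact: bounded_mfun_cst.
  apply: le_mean.
  - exact: (brho i (fun a => g j i a ^+ 2)).
  - apply: bounded_mfunD; last exact: bounded_mfun_cst.
    by apply: bounded_mfunX; exact: bounded_mfun_centered.
  move=> w; have := gc j i w; have := norm_centered_le i w (bh j) (hK j).
  have := gb j i (rho (X i w)); set x := g _ _ _; set y := centered _ _ _ => x1 y1 xy.
  (* Squares are compared through [x^2 - y^2 = (x - y) (x + y)], with both variables bounded by
     [2 K]. *)
  have : `|(x - y) * (x + y)| <= 2 * e * (4 * K).
    rewrite normrM ler_pM//; rewrite (le_trans (ler_normD _ _))//; lra.
  have : 0 <= e by exact: ltW.
  rewrite ler_norml => ? /andP[_]; lra.
have [x0 _] := exists_weights_gt0 (prod_weights pw).
pose S j (x : {ffun 'I_n -> A}) := \sum_i g j i (x i).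
have [w0 _] := probability_inhabited P.
have [j0 _] := Zmax w0.
pose t x := [arg max_(j > j0) S j x]%O.
have tmax j x : S j x <= S (t x) x.
  by rewrite /t; case: Order.TotalTheory.arg_maxP => // i _; exact.
pose rX := quotient_sample X rho.
pose Z' w := S (t (rX w)) (rX w).
have SX j w : `|S j (rX w) - centered_sum (h j) w| <= 2 * nR * e.
  rewrite /S /centered_sum -sumrB; apply: (le_trans (ler_norm_sum _ _ _)).
  have -> : 2 * nR * e = \sum_(i < n) 2 * e.
    by rewrite sumr_const card_ord -(mulr_natl (2 * e)) -/nR; ring.
  by apply: ler_sum => i _; rewrite ffunE.
(* The rounded maximum may have another maximizer; the maxima are nevertheless close because the two
   families are uniformly close. *)
have ZZ' w : `|Z' w - Z w| <= 2 * nR * e.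
  rewrite ler_norml; apply/andP; split.
    have [j ->] := Zmax w; have := tmax j (rX w); rewrite -/(Z' w).
    by have := SX j w; rewrite ler_norml => /andP[]; lra.
  have := Zge (t (rX w)) w; have := SX (t (rX w)) w.
  by rewrite -/(Z' w) ler_norml => /andP[]; lra.
have bZ' : bounded_mfun Z' by exact: (bounded_mfun_quotient_sample X mrho (fun x => S (t x) x)).
have EZ : `|mean P Z' - mean P Z| <= 2 * nR * e.
  by rewrite -meanB//; apply: norm_mean_le => //; exact: bounded_mfunB.
have := mgf_max_sum pw g0 gb gv tmax (mulr_ge0 (ler0n _ 2) K0) zK.
rewrite -(mean_quotient_sample mrho (fun x => expR (z * S (t x) x)) indep).
rewrite -(mean_quotient_sample mrho (fun x => S (t x) x) indep) -/(Z') => mgf.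
have h1 : mean P (fun w => expR (z * Z w)) <=
    expR (`|z| * (2 * nR * e)) * mean P (fun w => expR (z * Z' w)).
  rewrite -meanZ; last by apply: bounded_mfun_expR; exact: bounded_mfunZ.
  apply: le_mean.
  - by apply: bounded_mfun_expR; exact: bounded_mfunZ.
  - by apply: bounded_mfunZ; apply: bounded_mfun_expR; exact: bounded_mfunZ.
  move=> w; rewrite -expRD ler_expR.
  have : `|z * (Z w - Z' w)| <= `|z| * (2 * nR * e).
    by rewrite normrM ler_wpM2l// distrC.
  by rewrite ler_norml => /andP[]; lra.
apply: (le_trans h1); apply: (le_trans (ler_wpM2l (expR_ge0 _) mgf)).
rewrite -expRD ler_expR.
have h2 : z * mean P Z' <= z * mean P Z + `|z| * (2 * nR * e).
  have : `|z * (mean P Z' - mean P Z)| <= `|z| * (2 * nR * e) by rewrite normrM ler_wpM2l.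
  by rewrite ler_norml => /andP[]; lra.
have h3 : v + nR * ((8 * K + 4) * e) + 2 * K * mean P Z' <=
    v + 2 * K * mean P Z + (nR * (8 * K + 4) + 4 * K * nR) * e.
  have : mean P Z' <= mean P Z + 2 * nR * e by move: EZ; rewrite ler_norml => /andP[]; lra.
  by move=> /(ler_wpM2l (mulr_ge0 (ler0n _ 2) K0)); lra.
have : 0 <= 336 * z ^+ 2 by apply: mulr_ge0 => //; exact: sqr_ge0.
by move=> /ler_wpM2l /(_ _ _ h3); lra.
Qed.

End EmpiricalSums.

(** * Passage from finite maxima to a countable supremum *)

Section CountableSup.
Context (R : realType) (d d' : measure_display) (Om : measurableType d)
  (T : measurableType d') (P : probability Om R) (n : nat)
  (X : 'I_n -> {mfun Om >-> T}) (h : nat -> T -> R) (K v : R) (Z : Om -> R).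
Hypotheses (indep : mutually_independent P X)
  (mh : forall j, measurable_fun setT (h j)) (hK : forall j x, `|h j x| <= K)
  (K0 : 0 <= K) (hv : forall j, sum_var P X (h j) <= v)
  (Zge : forall j w, centered_sum P X (h j) w <= Z w)
  (Zsup : forall w e, 0 < e -> exists j, Z w - e < centered_sum P X (h j) w).

Let bh j : bounded_mfun (h j). Proof. by split => //; exists K. Qed.

Let S j w := centered_sum P X (h j) w.

Fixpoint running_max (m : nat) (w : Om) : R :=
  if m is m'.+1 then Num.max (running_max m' w) (S m w) else S 0 w.

Lemma bounded_mfun_running_max m : bounded_mfun (running_max m).
Proof.
elim: m => [|m [IH1 [M IH2]]] /=; first exact: bounded_mfun_centered_sum.
have [mS [N SN]] := bounded_mfun_centered_sum P X (bh m.+1).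
split; first exact: measurable_maxr.
exists (Num.max M N) => w; rewrite /Num.max; case: ifP => _; rewrite le_max.
  by rewrite SN orbT.
by rewrite IH2.
Qed.

Lemma le_running_max j m w : (j <= m)%N -> S j w <= running_max m w.
Proof.
elim: m => [|m IH]; first by rewrite leqn0 => /eqP ->.
rewrite leq_eqVlt => /predU1P[->|jm] /=; rewrite le_max ?lexx ?orbT//.
by rewrite IH.
Qed.

Lemma running_max_attained m w : exists j : 'I_m.+1, running_max m w = S j w.
Proof.
elim: m => [|m [j IH]] /=; first by exists ord0.
rewrite /Num.max; case: ifP => _; first by exists ord_max.
by exists (widen_ord (leqnSn _) j).
Qed.

Lemma running_max_cvg w : running_max ^~ w @ \oo --> Z w.
Proof.
apply/cvgrPdist_lt => e e0; have [j hj] := Zsup w e0.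
near=> m.
have jm : (j <= m)%N by near: m; exact: nbhs_infty_ge.
have := le_running_max w jm; have [i ->] := running_max_attained m w.
have := Zge i w; rewrite -/(S i w) => h1 h2.
rewrite ger0_norm; last by rewrite subr_ge0.
by move: hj; rewrite -/(S j w); lra.
Unshelve. all: end_near. Qed.

Let running_max_norm m w : `|running_max m w| <= n%:R * (2 * K).
Proof. by have [j ->] := running_max_attained m w; exact: norm_centered_sum_le. Qed.

Lemma bounded_mfun_sup : bounded_mfun Z.
Proof.
exact: (mean_cvg P bounded_mfun_running_max running_max_norm running_max_cvg).1.
Qed.

(** The running maxima are uniformly bounded and converge pointwise to [Z], so both sides of the
    finite inequality converge. *)
Lemma mgf_sup z : 336 * `|z| * (2 * K) <= 1 ->
  mean P (fun w => expR (z * Z w)) <=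
  expR (z * mean P Z + 336 * z ^+ 2 * (v + 2 * K * mean P Z)).
Proof.
move=> zK; have [_ cEZ] := mean_cvg P bounded_mfun_running_max running_max_norm running_max_cvg.
have [_ cexp] : bounded_mfun (fun w => expR (z * Z w)) /\
    (fun m => mean P (fun w => expR (z * running_max m w))) @ \oo -->
    mean P (fun w => expR (z * Z w)).
  apply: (@mean_cvg _ _ _ _ (fun m w => expR (z * running_max m w)) _
    (expR (`|z| * (n%:R * (2 * K))))).
  - by move=> m; apply: bounded_mfun_expR; apply: bounded_mfunZ; exact: bounded_mfun_running_max.
  - move=> m w; rewrite ger0_norm ?expR_ge0// ler_expR (le_trans (ler_norm _))// normrM.
    by rewrite ler_wpM2l.
  - move=> w; apply: continuous_cvg; first exact: continuous_expR.
    by apply: cvgMr; exact: running_max_cvg.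
have cexpE : (fun m => expR (z * mean P (running_max m) +
      336 * z ^+ 2 * (v + 2 * K * mean P (running_max m)))) @ \oo -->
    expR (z * mean P Z + 336 * z ^+ 2 * (v + 2 * K * mean P Z)).
  apply: continuous_cvg; first exact: continuous_expR.
  apply: cvgD; first exact: cvgMr.
  by apply: cvgMr; apply: cvgD; [exact: cvg_cst | exact: cvgMr].
apply: (ler_cvg_to cexp cexpE); apply: nearW => m.
apply: (mgf_finite_max (h := fun j : 'I_m.+1 => h j) indep) => //.
- exact: bounded_mfun_running_max.
- by move=> j w; apply: le_running_max; rewrite -ltnS.
- by move=> w; exact: running_max_attained.
Qed.

End CountableSup.

(** * The penalized empirical process *)

Section Process.
Context (R : realType) (C K : R) (hC : 0 < C) (n : nat) (hn : (0 < n)%N)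
  (d d' : measure_display) (Om : measurableType d) (T : measurableType d')
  (P : probability Om R) (X : 'I_n -> {mfun Om >-> T})
  (F : set (T -> R)) (pen : (T -> R) -> R) (f0 : T -> R).
Hypotheses (hX : mutually_independent P X)
  (hFmeas : forall f, F f -> measurable_fun setT f) (Ff0 : F f0)
  (hK : is_max [set sup_norm (f \- f0) | f in F] K%:E)
  (hcurv : forall f, F f ->
      avg_var P X (f \- f0) / C ^+ 2 <= pop_mean P X (f \- f0))
  (hpen : forall f, F f -> 0 <= pen f).

Lemma envelope_le f x : F f -> `|f x - f0 x| <= K.
Proof.
move=> Ff; rewrite -lee_fin; apply: (@le_trans _ _ (sup_norm (f \- f0))).
  by apply: ereal_sup_ubound; exists x.
by apply: hK.2; exists f.
Qed.

(** [T] has a point: a probability space is nonempty, and [n > 0] gives a sample variable to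
    evaluate there. *)
Lemma envelope_ge0 : 0 <= K.
Proof.
have [w _] := probability_inhabited P.
exact: le_trans (normr_ge0 _) (envelope_le (X (Ordinal hn) w) Ff0).
Qed.

Let diff f := f0 \- f.

Lemma diff_le f x : F f -> `|diff f x| <= K.
Proof. by move=> Ff; rewrite /diff /= distrC; exact: envelope_le. Qed.

Lemma bounded_mfun_diff f : F f -> bounded_mfun (diff f).
Proof.
move=> Ff; split; last by exists K => x; exact: diff_le.
by apply: measurable_funB; exact: hFmeas.
Qed.

Let nR : R := n%:R.
Let nR0 : 0 < nR. Proof. by rewrite ltr0n. Qed.

Lemma pop_meanE h : bounded_mfun h ->
  pop_mean P X h = nR^-1 * \sum_i mean P (fun w => h (X i w)).
Proof.
move=> bh; rewrite -[LHS]/(mean P (emp_mean X h)) /emp_mean meanZ.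
  by rewrite mean_sum// => i; exact: bounded_mfun_comp.
by apply: bounded_mfun_sum => i; exact: bounded_mfun_comp.
Qed.

Lemma deviationE f w : F f ->
  deviation P X f0 f w = nR^-1 * centered_sum P X (diff f) w.
Proof.
move=> Ff; rewrite /deviation pop_meanE; last exact: bounded_mfun_diff.
by rewrite /emp_mean -mulrBr -sumrB.
Qed.

Lemma pop_mean_diff f : F f -> pop_mean P X (f \- f0) = - pop_mean P X (diff f).
Proof.
move=> Ff; have bd := bounded_mfun_diff Ff.
have -> : f \- f0 = (fun x => (-1) * diff f x) by apply/funext => x; rewrite /diff /=; ring.
rewrite !pop_meanE//; last exact: bounded_mfunZ.
rewrite -mulrN -sumrN; congr (_ * _); apply: eq_bigr => i _.
by rewrite meanZ ?mulN1r//; exact: bounded_mfun_comp.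
Qed.

Lemma sum_varE f : F f -> sum_var P X (diff f) = nR * avg_var P X (f \- f0).
Proof.
move=> Ff; rewrite /avg_var mulrA mulfV ?gt_eqF// mul1r; apply: eq_bigr => i _.
have bd : bounded_mfun (fun w => diff f (X i w)).
  by apply: bounded_mfun_comp; exact: bounded_mfun_diff.
rewrite -!/(mean P _) /centered; set m := mean P (fun w => diff f (X i w)).
have -> : mean P (fun w => (f \- f0) (X i w)) = - m.
  have -> : (fun w => (f \- f0) (X i w)) = (fun w => (-1) * diff f (X i w)).
    by apply/funext => w; rewrite /diff /=; ring.
  by rewrite meanZ// mulN1r.
have -> : (fun w => (f \- f0) (X i w) ^+ 2) = (fun w => diff f (X i w) ^+ 2).
  by apply/funext => w; rewrite /diff /=; ring.
have -> : (fun w => (diff f (X i w) - m) ^+ 2) =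
    (fun w => diff f (X i w) ^+ 2 - (2 * m * diff f (X i w) - m ^+ 2)).
  by apply/funext => w; ring.
rewrite meanB; last 2 first.
- exact: bounded_mfunX.
- by apply: bounded_mfunB; [exact: bounded_mfunZ | exact: bounded_mfun_cst].
rewrite meanB; last 2 first.
- exact: bounded_mfunZ.
- exact: bounded_mfun_cst.
by rewrite meanZ// mean_cst -/m; ring.
Qed.

(** Quadratic curvature bounds the variance by [C^2] times the excess risk, and the excess risk is
    at most [tau2] because the penalty is nonnegative. *)
Lemma sum_var_le f s : F f -> tau P X f0 pen f <= s ->
  sum_var P X (diff f) <= nR * (C ^+ 2 * s ^+ 2).
Proof.
move=> Ff fs; rewrite sum_varE// ler_pM2l//.
have := hcurv Ff; rewrite ler_pdivrMr ?exprn_gt0// mulrC => /le_trans; apply.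
rewrite ler_pM2l ?exprn_gt0//.
apply: (@le_trans _ _ (tau2 P X f0 pen f)).
  by rewrite /tau2 lerDl hpen.
apply: (@le_trans _ _ (tau P X f0 pen f ^+ 2)).
  (* The square root vanishes at negative arguments, so [tau2 <= tau^2] holds for either sign. *)
  rewrite /tau; have [t0|t0] := leP 0 (tau2 P X f0 pen f); first by rewrite sqr_sqrtr.
  by rewrite (le_trans (ltW t0))// sqr_ge0.
by rewrite lerXn2r ?nnegrE ?sqrtr_ge0// (le_trans _ fs)// sqrtr_ge0.
Qed.

Context (tau_min : R) (tau_min0 : 0 <= tau_min).
Hypotheses (htau_min : is_min [set tau2 P X f0 pen f | f in F] (tau_min ^+ 2))
  (hmax : forall s w, tau_min <= s ->
      exists m, is_max
        [set deviation P X f0 f w | f in sublevel P X F f0 pen s] m)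
  (hsep : forall s, tau_min <= s ->
      separable_deviation P X f0 (sublevel P X F f0 pen s)).

Let Ehat s w := emp_E P X F f0 pen s w.
Let E s := mean_E P X F f0 pen s.

(** [emp_E] is a real supremum, which is meaningful only for nonempty bounded sets; the existence of
    a maximum guarantees this and identifies the two. *)
Lemma emp_E_is_max s w : tau_min <= s ->
  is_max [set deviation P X f0 f w | f in sublevel P X F f0 pen s] (Ehat s w).
Proof.
move=> st; have [m [ms mub]] := hmax w st.
suff -> : Ehat s w = m by split.
apply/eqP; rewrite eq_le; apply/andP; split.
  by apply: ge_sup => //; exists m.
by apply: ub_le_sup => //; exists m.
Qed.

Lemma tau_ge f : F f -> tau_min <= tau P X f0 pen f.
Proof.
move=> Ff; rewrite /tau -(ger0_norm tau_min0) -sqrtr_sqr ler_wsqrtr//.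
by apply: htau_min.2; exists f.
Qed.

Lemma sqr_tau f : F f -> tau P X f0 pen f ^+ 2 = tau2 P X f0 pen f.
Proof.
move=> Ff; rewrite sqr_sqrtr// (le_trans (sqr_ge0 tau_min))//.
by apply: htau_min.2; exists f.
Qed.

Lemma emp_E_homo s s' w : tau_min <= s -> s <= s' -> Ehat s w <= Ehat s' w.
Proof.
move=> st ss'; have [[f [Ff fs] <-] _] := emp_E_is_max w st.
apply: (emp_E_is_max w (le_trans st ss')).2; exists f => //; split => //.
exact: le_trans ss'.
Qed.

(** The penalized empirical risk is [tau2 f - deviation f] plus a term independent of [f]. Compare
    [fh] with a maximizer of the deviation at radius [s], whose [tau2] is at most [s^2], and bound
    the deviation of [fh] by the maximum at its own radius. *)
Lemma erm_excess (fh : T -> R) s w : F fh ->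
  (forall f, F f -> emp_mean X fh w + pen fh <= emp_mean X f w + pen f) ->
  tau_min <= s ->
  tau P X f0 pen fh ^+ 2 - Ehat (tau P X f0 pen fh) w <= s ^+ 2 - Ehat s w.
Proof.
move=> Ffh hmin st.
have key f : F f -> emp_mean X f w + pen f =
    tau2 P X f0 pen f - deviation P X f0 f w + emp_mean X f0 w.
  move=> Ff; rewrite /tau2 /deviation pop_mean_diff// -/(diff f).
  have -> : emp_mean X (diff f) w = emp_mean X f0 w - emp_mean X f w.
    by rewrite /emp_mean -mulrBr -sumrB.
  by ring.
have [[f [Ff fs] <-] _] := emp_E_is_max w st.
have := hmin _ Ff; rewrite !key// lerD2r => h.
have := (emp_E_is_max w (tau_ge Ffh)).2 (deviation P X f0 fh w).
rewrite sqr_tau// => /(_ _)/wrap[]; first by exists fh.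
have : tau2 P X f0 pen f <= s ^+ 2.
  rewrite -sqr_tau// lerXn2r ?nnegrE ?sqrtr_ge0//.
  exact: le_trans (sqrtr_ge0 _) fs.
by lra.
Qed.

(** Enumerating the countable subclass given by separability puts the process into the form required
    for a countable supremum. *)
Lemma process_sup s : tau_min <= s -> exists h : nat -> T -> R,
  [/\ forall j, sublevel P X F f0 pen s (h j),
      forall j w, centered_sum P X (diff (h j)) w <= nR * Ehat s w &
      forall w e, 0 < e -> exists j, nR * Ehat s w - e < centered_sum P X (diff (h j)) w].
Proof.
move=> st; have [D [D0 DF cD Dsup]] := hsep st.
have [D0'|[h]] := pfcard_geP cD; first by move: D0; rewrite D0' => -[].
have hD j : D (h j) by exact: funS.
have DFF f : D f -> F f by move=> /DF[].
exists h; split.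
- by move=> j; exact: DF.
- move=> j w; rewrite -ler_pdivrMl// -deviationE//; last exact: DFF.
  by apply: (emp_E_is_max w st).2; exists (h j) => //; exact: DF.
- move=> w e e0.
  have hs : has_sup [set deviation P X f0 f w | f in D].
    split; first by have [f Df] := D0; exists (deviation P X f0 f w); exists f.
    exists (Ehat s w) => _ [f Df <-].
    by apply: (emp_E_is_max w st).2; exists f => //; exact: DF.
  have e0' : 0 < e / nR by exact: divr_gt0.
  have [_ [f Df <-]] := sup_adherent e0' hs.
  rewrite -[sup _]/(max_deviation P X f0 D w) -Dsup -/(emp_E P X F f0 pen s w) -/(Ehat s w).
  have [j _ jf] := 'surj_h Df.
  rewrite deviationE; last exact: DFF.
  move=> hlt; exists j; rewrite jf.
  have -> : nR * Ehat s w - e = nR * (Ehat s w - e / nR) by field; rewrite gt_eqF.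
  by rewrite -ltr_pdivlMl.
Qed.

Lemma bounded_mfun_emp_E s : tau_min <= s -> bounded_mfun (Ehat s).
Proof.
move=> st; have [h [hF hge hsup]] := process_sup st.
have hFF j : F (h j) by have [] := hF j.
have := bounded_mfun_sup (fun j => (bounded_mfun_diff (hFF j)).1)
  (fun j x => diff_le x (hFF j)) hge hsup.
move=> /(bounded_mfunZ nR^-1); congr bounded_mfun; apply/funext => w.
by rewrite mulrA mulVf ?gt_eqF// mul1r.
Qed.

(** This is [mgf_sup] after rescaling by [n], with the variance bound [n C^2 s^2]; centering at
    [E s] cancels the term linear in [z]. *)
Lemma mgf_emp_E s z : tau_min <= s -> 336 * `|z| * (2 * K) <= 1 ->
  mean P (fun w => expR (z * nR * (Ehat s w - E s))) <=
  expR (336 * z ^+ 2 * nR * (C ^+ 2 * s ^+ 2 + 2 * K * E s)).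
Proof.
move=> st zK; have [h [hF hge hsup]] := process_sup st.
have hFF j : F (h j) by have [] := hF j.
have bE := bounded_mfun_emp_E st.
have := mgf_sup hX (fun j => (bounded_mfun_diff (hFF j)).1)
  (fun j x => diff_le x (hFF j)) envelope_ge0
  (fun j => sum_var_le (hFF j) (hF j).2) hge hsup zK.
rewrite meanZ// -[mean P (Ehat s)]/(E s) => h1.
have -> : (fun w => expR (z * nR * (Ehat s w - E s))) =
   (fun w => expR (- (z * nR * E s)) * expR (z * (nR * Ehat s w))).
  by apply/funext => w; rewrite -expRD; congr expR; ring.
rewrite meanZ; last by apply: bounded_mfun_expR; apply: bounded_mfunZ; exact: bounded_mfunZ.
apply: (le_trans (ler_wpM2l (expR_ge0 _) h1)); rewrite -expRD ler_expR.
by rewrite le_eqVlt; apply/orP; left; apply/eqP; ring.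
Qed.

End Process.

(** * Margin functions *)

Section MarginFunction.
Context (R : realType) (G : R -> R) (hG : margin_function G).

Lemma margin_function_homo u u' : 0 <= u -> u <= u' -> G u <= G u'.
Proof.
have [_ Ginc _] := hG; move=> u0; rewrite le_eqVlt => /predU1P[->//|uu'].
by apply/ltW/Ginc => //; rewrite in_itv/= andbT// (le_trans u0 (ltW uu')).
Qed.

Lemma margin_function_convex l u u' : 0 <= u -> 0 <= u' -> 0 <= l <= 1 ->
  G (l * u + (1 - l) * u') <= l * G u + (1 - l) * G u'.
Proof.
have [Gc _ _] := hG; move=> u0 u'0 /andP[l0 l1].
have [->|uu'] := eqVneq u u'.
  by rewrite -!mulrDl addrC subrK !mul1r.
move: l0; rewrite le_eqVlt => /predU1P[<-|l0]; first by rewrite !mul0r !add0r subr0 !mul1r.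
move: l1; rewrite le_eqVlt => /predU1P[->|l1]; first by rewrite subrr !mul0r !addr0 !mul1r.
apply/ltW/Gc => //=; first by rewrite in_itv /= andbT.
  by rewrite in_itv /= andbT.
by rewrite l0 l1.
Qed.

Lemma margin_function1_gt0 : 0 < G 1.
Proof.
have [_ Ginc G0] := hG; rewrite -[ltLHS]G0; apply: Ginc => //;
by rewrite in_itv /= ?lexx ?ler01.
Qed.

Lemma margin_function_le_linear u : 0 <= u <= 1 -> G u <= u * G 1.
Proof.
have [_ _ G0] := hG; move=> u01.
have := margin_function_convex ler01 (lexx 0) u01.
by rewrite mulr1 mulr0 addr0 G0 mulr0 addr0.
Qed.

Lemma margin_function_ge_linear u : 1 <= u -> u * G 1 <= G u.
Proof.
have [_ _ G0] := hG; move=> u1; have u0 : 0 < u by lra.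
have := @margin_function_convex u^-1 u 0 (ltW u0) (lexx 0) _.
rewrite mulVf ?gt_eqF// mulr0 addr0 G0 mulr0 addr0 => h.
rewrite mulrC -ler_pdivlMr// mulrC; apply: h.
by rewrite invr_ge0 (ltW u0) invf_le1.
Qed.

(** Take [s] as the supremum of the sublevel set of [r]. Linear growth beyond 1 makes it finite, and
    the linear bound near 0 makes it positive. Convexity supplies the continuity at [s], in the form
    of two bounds with a slack linear in [e]. *)
Lemma margin_function_onto r : 0 < r -> exists2 u, 0 < u & G u = r.
Proof.
move=> r0; have [_ _ G0] := hG; have G1 := margin_function1_gt0.
pose A := [set u | 0 <= u /\ G u <= r].
have A0 : A 0 by split => //; rewrite G0 ltW.
have Aub : has_ubound A.
  exists (1 + r / G 1) => u [u0 Gu]; have [u1|u1] := leP u 1.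
    by rewrite (le_trans u1)// lerDl divr_ge0// ltW.
  have : u <= r / G 1.
    by rewrite ler_pdivlMr// (le_trans (margin_function_ge_linear (ltW u1))).
  by lra.
have hsA : has_sup A by split => //; exists 0.
pose s := sup A.
have sge u : A u -> u <= s by move=> Au; apply: ub_le_sup.
have s0 : 0 < s.
  pose u := Num.min 1 (r / G 1).
  have u0 : 0 < u by rewrite lt_min ltr01 divr_gt0.
  apply: (lt_le_trans u0); apply: sge; split; first exact: ltW.
  apply: (@le_trans _ _ (u * G 1)).
    by apply: margin_function_le_linear; rewrite ltW//= ge_min lexx.
  by rewrite -ler_pdivlMr// ge_min lexx orbT.
have s1r : r <= G (s + 1).
  rewrite leNgt; apply/negP => h.
  have : s + 1 <= s by apply: sge; split; lra.
  by lra.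
exists s => //; apply/eqP; rewrite eq_le; apply/andP; split.
- apply: (@le_of_slack _ _ _ (G (s + 1) - r)) => e /andP[e0 e1].
  pose q := Num.min e s.
  have q0 : 0 < q by rewrite lt_min e0 s0.
  have qe : q <= e by rewrite ge_min lexx.
  have qs : q <= s by rewrite ge_min lexx orbT.
  have [u [u0 Gu] us] := sup_adherent q0 hsA.
  have Gsq : G (s - q) <= r.
    by apply: le_trans Gu; apply: margin_function_homo; [lra | exact: ltW].
  have q1 : 0 < 1 + q by lra.
  (* This weight writes [s] as a convex combination of [s - q], where [G] is at most [r], and
     [s + 1]. *)
  pose l := (1 + q)^-1.
  have l0 : 0 < l by rewrite invr_gt0.
  have lq : l * (1 + q) = 1 by rewrite mulVf// gt_eqF.
  have l1 : l <= 1 by rewrite invf_le1//; lra.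
  have := @margin_function_convex l (s - q) (s + 1).
  have -> : l * (s - q) + (1 - l) * (s + 1) = s by lra.
  rewrite l1 (ltW l0) => /(_ _ _ isT) h.
  have {}h : G s <= l * G (s - q) + (1 - l) * G (s + 1) by apply: h; lra.
  have : l * G (s - q) <= l * r by rewrite ler_pM2l.
  have : (1 - l) * (G (s + 1) - r) <= e * (G (s + 1) - r).
    apply: ler_wpM2r; first by rewrite subr_ge0.
    have : l * q <= 1 * q by apply: ler_wpM2r => //; exact: ltW.
    by lra.
  by lra.
- apply: (@le_of_slack _ _ _ (G (s + 1) - G s)) => e /andP[e0 e1].
  have h : r <= G (s + e).
    rewrite leNgt; apply/negP => h.
    have : s + e <= s by apply: sge; split; lra.
    by lra.
  apply: (le_trans h).
  have := @margin_function_convex (1 - e) s (s + 1).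
  have -> : (1 - e) * s + (1 - (1 - e)) * (s + 1) = s + e by ring.
  move=> h2; have {}h2 := h2 _ _ _.
  by have := h2 (ltW s0); lra.
Qed.

(** Test the bound at [u = e] near 0, where [G] is at most linear. *)
Lemma convex_conjugate_ge0 v g : 0 <= v ->
  (forall u, 0 < u -> v * u - G u <= g) -> 0 <= g.
Proof.
move=> v0 H; apply: (@le_of_slack _ _ _ (G 1)) => e /andP[e0 e1].
have := H e e0; have : 0 <= v * e by rewrite mulr_ge0// ltW.
have := @margin_function_le_linear e; rewrite e1 (ltW e0) => /(_ isT).
by lra.
Qed.

End MarginFunction.

(** * Tail of the fluctuation increment between two radii *)

Section TwoPointTail.
Context (R : realType) (d : measure_display) (Om : measurableType d)
  (P : probability Om R).

(* The factor 1344 is 336 * 2^2: the hypotheses are used at [2 z] and [- 2 z]. *)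
Lemma two_point_tail (U L : Om -> R) (N K v l : R) :
  bounded_mfun U -> bounded_mfun L -> 0 < N -> 0 <= K -> 0 <= v -> 0 < l ->
  (forall z, 336 * `|z| * (2 * K) <= 1 ->
    mean P (fun w => expR (z * N * U w)) <= expR (336 * z ^+ 2 * N * v ^+ 2)) ->
  (forall z, 336 * `|z| * (2 * K) <= 1 ->
    mean P (fun w => expR (z * N * L w)) <= expR (336 * z ^+ 2 * N * v ^+ 2)) ->
  (P [set w | (1345 * (v * Num.sqrt (l / N) + 1344 * (K + 1) * (l / N)) <= U w - L w)%R]
    <= (expR (- l))%:E)%E.
Proof.
move=> bU bL N0 K0 v0 l0 mU mL.
pose M := 1344 * (K + 1); have M0 : 0 < M by rewrite /M; lra.
pose r := Num.sqrt (l / N); have r0 : 0 < r by rewrite sqrtr_gt0 divr_gt0.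
have r2 : r ^+ 2 = l / N by rewrite sqr_sqrtr// ltW// divr_gt0.
rewrite -/r -/M -r2; set x := 1345 * _.
have lE : l = N * r ^+ 2 by rewrite r2; field; rewrite gt_eqF.
have [z [z0 zM zx]] : exists z, [/\ 0 < z, z * M <= 1 &
    1344 * z ^+ 2 * N * v ^+ 2 - z * N * x <= - l].
  (* In the Gaussian regime the free optimum [z = r / v] is admissible; otherwise [z] takes its
     largest value [1 / M]. In both cases the quadratic term is at most [1344 l] and the linear one
     at least [1345 l], which explains 1345 = 1344 + 1. *)
  have [rMv|rMv] := leP (r * M) v.
  - have vgt0 : 0 < v by apply: lt_le_trans rMv; exact: mulr_gt0.
    exists (r / v); split; first exact: divr_gt0.
      by rewrite mulrAC ler_pdivrMr// mul1r.
    have -> : 1344 * (r / v) ^+ 2 * N * v ^+ 2 - r / v * N * x =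
        - l - 1345 * (r / v * N * (M * r ^+ 2)).
      by rewrite lE /x; field; rewrite gt_eqF.
    have : 0 <= r / v * N * (M * r ^+ 2).
      apply: mulr_ge0; first by apply: mulr_ge0; [apply: divr_ge0 | ]; exact: ltW.
      by apply: mulr_ge0; [exact: ltW | exact: sqr_ge0].
    by lra.
  - exists M^-1; split; first by rewrite invr_gt0.
      by rewrite mulVf// gt_eqF.
    have h : v / M <= r by rewrite ler_pdivrMr// ltW.
    have h2 : (v / M) ^+ 2 <= r ^+ 2 by rewrite lerXn2r ?nnegrE ?divr_ge0// ltW.
    have -> : 1344 * M^-1 ^+ 2 * N * v ^+ 2 - M^-1 * N * x =
        1344 * (N * (v / M) ^+ 2) - 1345 * l - 1345 * (N * (v / M) * r).
      by rewrite lE /x; field; rewrite gt_eqF.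
    have : N * (v / M) ^+ 2 <= l by rewrite lE ler_pM2l.
    have : 0 <= N * (v / M) * r.
      apply: mulr_ge0; last exact: ltW.
      by apply: mulr_ge0; [exact: ltW | apply: divr_ge0 => //; exact: ltW].
    by lra.
have zN : 0 < z * N by exact: mulr_gt0.
have zK : 336 * `|2 * z| * (2 * K) <= 1.
  rewrite gtr0_norm; last by rewrite mulr_gt0.
  by apply: le_trans zM; rewrite /M; lra.
have -> : [set w | x <= U w - L w] = [set w | 0 <= z * N * (U w - L w) - z * N * x].
  by apply/seteqP; split => w /=; rewrite subr_ge0 ler_pM2l.
have bUL : bounded_mfun (fun w => z * N * (U w - L w)).
  by apply: bounded_mfunZ; exact: bounded_mfunB.
apply: le_trans (chernoff _ _) _.
  by apply: bounded_mfunB => //; exact: bounded_mfun_cst.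
rewrite lee_fin.
have b1 : bounded_mfun (fun w => expR (2 * z * N * U w)).
  by apply: bounded_mfun_expR; exact: bounded_mfunZ.
have b2 : bounded_mfun (fun w => expR (- (2 * z) * N * L w)).
  by apply: bounded_mfun_expR; exact: bounded_mfunZ.
(* By [2 e^(a - b) <= e^(2 a) + e^(- 2 b)] the two variables are handled separately, whatever their
   dependence; this doubles the parameter. *)
apply: (@le_trans _ _ (mean P (fun w => expR (- (z * N * x)) * (2^-1 *
   (expR (2 * z * N * U w) + expR (- (2 * z) * N * L w)))))).
  apply: le_mean.
  - by apply: bounded_mfun_expR; apply: bounded_mfunB => //; exact: bounded_mfun_cst.
  - by do 2 apply: bounded_mfunZ; exact: bounded_mfunD.
  move=> w; rewrite addrC expRD ler_pM2l ?expR_gt0//.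
  have -> : z * N * (U w - L w) = z * N * U w + - (z * N * L w) by ring.
  have -> : 2 * z * N * U w = z * N * U w + z * N * U w by ring.
  have -> : - (2 * z) * N * L w = - (z * N * L w) + - (z * N * L w) by ring.
  rewrite !expRD; have := sqr_ge0 (expR (z * N * U w) - expR (- (z * N * L w))).
  by lra.
rewrite meanZ; last by apply: bounded_mfunZ; exact: bounded_mfunD.
rewrite meanZ; last exact: bounded_mfunD.
rewrite meanD//.
have := mU (2 * z) zK; have := mL (- (2 * z)); rewrite normrN => /(_ zK).
rewrite sqrrN; have -> : 336 * (2 * z) ^+ 2 * N * v ^+ 2 = 1344 * z ^+ 2 * N * v ^+ 2 by ring.
set e := expR (1344 * z ^+ 2 * N * v ^+ 2) => h1 h2.
apply: (@le_trans _ _ (expR (- (z * N * x)) * e)).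
  by rewrite ler_pM2l ?expR_gt0//; lra.
by rewrite /e -expRD ler_expR addrC.
Qed.

End TwoPointTail.

(** Fenchel's inequality at the point [u = J s], where [Phi] takes the value [s^2]. *)
Lemma mean_le_conjugate (R : realType) (C K r0 tau_min m s e : R) (J : R -> R) :
  0 < C -> 0 <= K -> 0 <= r0 -> 0 < m -> tau_min <= s ->
  {in `[tau_min, +oo[ &, {homo J : x y / x < y}} -> J tau_min = 0 ->
  e <= J s / m ->
  ((r0 ^+ 2)%:E = (2 * C ^+ 2)%:E *
      convex_conjugate (Phi tau_min J) (4 * K / (m * C ^+ 2)))%E ->
  4 * K * e <= C ^+ 2 * s ^+ 2 + r0 ^+ 2 / 2.
Proof.
(* At [s = tau_min] the point [J s = 0] lies outside the range [u > 0] of the conjugate; there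
   [e <= 0] suffices. *)
move=> C0 K0 r00 m0; rewrite le_eqVlt => /predU1P[<-|ts] Jinc J0 eJ hr.
  move: eJ; rewrite J0 mul0r => e0.
  have : 4 * K * e <= 0 by rewrite mulr_ge0_le0// mulr_ge0.
  by have := mulr_ge0 (sqr_ge0 C) (sqr_ge0 tau_min); have := sqr_ge0 r0; lra.
have C2 : 0 < C ^+ 2 by rewrite exprn_gt0.
have Js : 0 < J s.
  by rewrite -J0; apply: Jinc => //; rewrite in_itv /= ?lexx ?(ltW ts).
have PhiJ : Phi tau_min J (J s) = s ^+ 2.
  rewrite /Phi pinvKV//; last by rewrite inE /= in_itv /= (ltW ts).
  move=> x y; rewrite !inE /= => hx hy Jxy.
  have [xy|xy|//] := ltgtP x y; [have := Jinc _ _ hx hy xy | have := Jinc _ _ hy hx xy];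
  by rewrite Jxy ltxx.
have : ((4 * K / (m * C ^+ 2) * J s - s ^+ 2)%:E <=
    convex_conjugate (Phi tau_min J) (4 * K / (m * C ^+ 2)))%E.
  rewrite -PhiJ; apply: ereal_sup_ubound; exists (J s) => //=.
  by rewrite in_itv /= Js.
have hC : (0 < (2 * C ^+ 2)%:E)%E by rewrite lte_fin; lra.
rewrite -(lee_pmul2l _ hC)// -hr -EFinM lee_fin.
have -> : 2 * C ^+ 2 * (4 * K / (m * C ^+ 2) * J s - s ^+ 2) =
    8 * K * (J s / m) - 2 * (C ^+ 2 * s ^+ 2).
  by field; rewrite !gt_eqF.
have := ler_wpM2l K0 eJ.
by lra.
Qed.

(** * Localization of the empirical minimizer *)

Section Peeling.
Context (R : realType) (d : measure_display) (Om : measurableType d)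
  (P : probability Om R) (Eh : R -> Om -> R) (E : R -> R) (sh : Om -> R)
  (x : R -> R) (s0 tau_min tau_max t : R) (n : nat).
Let l := t + ln (1 + Num.sqrt (n%:R * tau_max ^+ 2)).
Hypotheses (n0 : (0 < n)%N) (t0 : 0 < t) (msh : measurable_fun setT sh)
  (tau_min0 : 0 <= tau_min) (sh_ge : forall w, tau_min <= sh w)
  (erm : forall w, sh w ^+ 2 - Eh (sh w) w <= s0 ^+ 2 - Eh s0 w)
  (homo : forall s s' w, tau_min <= s -> s <= s' -> Eh s w <= Eh s' w)
  (bE : forall s, tau_min <= s -> bounded_mfun (Eh s))
  (s0_ge : tau_min <= s0)
  (tail : forall s, tau_min <= s ->
    (P [set w | (x s <= (Eh s w - E s) - (Eh s0 w - E s0))%R] <= (expR (- l))%:E)%E).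

(** Round [sh] up to the next grid radius. Monotonicity of [Eh] and the inequality [erm] force the
    fluctuation increment at that radius to reach [x], at the price of the change in [s^2]. A union
    bound over the grid concludes. *)
Lemma peeling (a b : R) : tau_min <= a -> a < b -> b <= tau_max ->
  (forall s, a < s <= b ->
     x s + 4 * s * Num.sqrt (rate n tau_max t) < (s ^+ 2 - E s) - (s0 ^+ 2 - E s0)) ->
  (P [set w | (a <= sh w <= b)%R] <= (expR (- t))%:E)%E.
Proof.
move=> ta ab bt excess; have tm_ge0 := tau_min0; have tpos := t0.
pose q : R := Num.sqrt n%:R.
have q0 : 0 < q by rewrite sqrtr_gt0 ltr0n.
have q2 : q ^+ 2 = n%:R by rewrite sqr_sqrtr.
have tm0 : 0 < tau_max.
  exact: le_lt_trans (le_trans tau_min0 ta) (lt_le_trans ab bt).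
pose m := q * tau_max; have m0 : 0 < m by exact: mulr_gt0.
have mE : Num.sqrt (n%:R * tau_max ^+ 2) = m.
  by rewrite sqrtrM// sqrtr_sqr gtr0_norm.
(* This count makes the cells no longer than [1 / sqrt n] and keeps [N <= 1 + m]. *)
pose N := (Num.trunc (q * (b - a))).+1.
have qba : 0 <= q * (b - a) by apply: mulr_ge0; [exact: ltW | lra].
have /andP[N1 N2] : N%:R - 1 <= q * (b - a) < N%:R.
  by have := Num.Theory.truncn_itv qba; rewrite /N -natr1 addrK.
have NR0 : 0 < N%:R :> R by rewrite ltr0n.
pose len := (b - a) / N%:R.
have lN : len * N%:R = b - a by rewrite divfK// gt_eqF.
have len0 : 0 < len by rewrite divr_gt0// subr_gt0.
have len1 : len * q <= 1.
  by rewrite /len mulrAC ler_pdivrMr// mul1r mulrC ltW.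
have len2 : len <= tau_max.
  have : len * 1 <= len * N%:R by rewrite ler_pM2l// ler1n.
  by lra.
have ln_m : m / (1 + m) <= ln (1 + m).
  have h : 0 < 1 + m by lra.
  have : ln (1 + ((1 + m)^-1 - 1)) <= (1 + m)^-1 - 1.
    by apply: le_ln1Dx; have : 0 < (1 + m)^-1 by [rewrite invr_gt0]; lra.
  rewrite addrC subrK lnV ?posrE//.
  have -> : m / (1 + m) = 1 - (1 + m)^-1 by field; rewrite gt_eqF.
  by lra.
pose r := Num.sqrt (rate n tau_max t).
(* Here [(len q)^2] is at most both 1 and [m], hence at most [2 m / (1 + m) <= 2 ln (1 + m)]: the
   logarithm in the rate already pays for the mesh. *)
have len_r : len <= 2 * r.
  have : len ^+ 2 <= 4 * rate n tau_max t.
    rewrite /rate mE mulrA ler_pdivlMr ?ltr0n// -q2 -exprMn.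
    suff : (len * q) ^+ 2 <= 2 * ln (1 + m).
      have m1 : 0 < 1 + m by lra.
      by have := le_trans (divr_ge0 (ltW m0) (ltW m1)) ln_m; lra.
    apply: (@le_trans _ _ (2 * (m / (1 + m)))); last by rewrite ler_pM2l.
    have lq0 : 0 <= len * q by rewrite mulr_ge0// ltW.
    have lqm : len * q <= m by rewrite /m mulrC ler_pM2l.
    rewrite mulrA ler_pdivlMr; last lra.
    have h1 : (len * q) ^+ 2 <= 1 by rewrite -(expr1n _ 2) lerXn2r ?nnegrE.
    have h2 : (len * q) ^+ 2 <= m.
      by apply: le_trans lqm; rewrite expr2 ler_piMr.
    have : (len * q) ^+ 2 * m <= 1 * m by rewrite ler_wpM2r// ltW.
    by lra.
  move=> h; rewrite -[len]ger0_norm ?(ltW len0)// -sqrtr_sqr.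
  have -> : 2 * r = Num.sqrt (4 * rate n tau_max t).
    rewrite sqrtrM//; congr (_ * _).
    by rewrite (_ : 4 = 2 ^+ 2) ?sqrtr_sqr ?ger0_norm//; ring.
  exact: ler_wsqrtr.
(* The right end of cell [j], so that the grid radius lies above [sh]. *)
pose sj (j : nat) := a + j.+1%:R * len.
pose A (j : nat) := [set w | (x (sj j) <= (Eh (sj j) w - E (sj j)) - (Eh s0 w - E s0))%R].
have sj_gt j : a < sj j by rewrite ltrDl mulr_gt0.
have sj_ge j : tau_min <= sj j by rewrite (le_trans ta)// ltW.
have mA j : measurable (A j).
  rewrite (_ : A j = (fun w => Eh (sj j) w - E (sj j) - (Eh s0 w - E s0)) @^-1`
      `[x (sj j), +oo[); last first.
    by apply/seteqP; split => w /=; rewrite in_itv /= andbT.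
  rewrite -[_ @^-1` _]setTI.
  have bf : bounded_mfun (fun w => Eh (sj j) w - E (sj j) - (Eh s0 w - E s0)).
    by do 2?apply: bounded_mfunB => //; try exact: bounded_mfun_cst; exact: bE.
  by apply bf => //; exact: measurable_itv.
have sub : [set w | a <= sh w <= b] `<=` \big[setU/set0]_(j < N) A j.
  move=> w /= /andP[ash shb]; rewrite -bigcup_mkord.
  pose k := Num.trunc ((sh w - a) / len).
  have /andP[k1 k2] : k%:R <= (sh w - a) / len < k.+1%:R.
    by apply: Num.Theory.truncn_itv; rewrite divr_ge0 ?subr_ge0// ltW.
  rewrite ler_pdivlMr// in k1; rewrite ltr_pdivrMr// in k2.
  (* The index [k] can reach [N] at the endpoint [sh w = b]; the last cell, whose right end is [b],
     is used then. *)
  have [j jN [j1 j2]] : exists2 j, (j < N)%N & sh w <= sj j /\ sj j <= sh w + len.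
    have [kN|Nk] := ltnP k N.
      by exists k => //; rewrite /sj; split; move: k1 k2; rewrite -natr1; lra.
    exists N.-1; first by rewrite prednK.
    have NE : sj N.-1 = b by rewrite /sj prednK// mulrC lN; ring.
    rewrite NE; split => //.
    have : N%:R * len <= k%:R * len by rewrite ler_pM2r// ler_nat.
    by lra.
  have sjb : sj j <= b.
    have : j.+1%:R * len <= N%:R * len by rewrite ler_pM2r// ler_nat.
    by rewrite /sj; lra.
  exists j => //; rewrite /A /=.
  have := excess (sj j); rewrite sj_gt sjb => /(_ isT).
  have := homo w (sh_ge w) j1; have := erm w.
  rewrite -/r.
  have sh0 : 0 <= sh w by exact: le_trans (sh_ge w).
  (* The radii differ by at most [2 r] and sum to at most [2 sj j]; this is the extra term in the
     hypothesis [excess]. *)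
  have : sj j ^+ 2 - sh w ^+ 2 <= 4 * sj j * r.
    rewrite subr_sqr.
    apply: (@le_trans _ _ ((2 * r) * (2 * sj j))); last first.
      by rewrite le_eqVlt; apply/orP; left; apply/eqP; ring.
    by apply: ler_pM; lra.
  by lra.
have mS : measurable [set w | a <= sh w <= b].
  rewrite (_ : [set w | _] = sh @^-1` `[a, b]); last first.
    by apply/seteqP; split => w /=; rewrite in_itv.
  by rewrite -[_ @^-1` _]setTI; apply: msh => //; exact: measurable_itv.
apply: (@le_trans _ _ (P (\big[setU/set0]_(j < N) A j))).
  by apply: le_measure => //; rewrite inE//; apply: bigsetU_measurable.
apply: (le_trans (Boole_inequality P (fun j (_ : (j < N)%N) => mA j))).
apply: (@le_trans _ _ (\sum_(j < N) (expR (- l))%:E)%E).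
  by apply: lee_sum => j _; exact: tail.
rewrite sumEFin lee_fin sumr_const card_ord -(mulr_natl (expR _)).
have m1 : 0 < 1 + m by lra.
(* The logarithm in [l] makes each tail [exp (- t) / (1 + m)], which pays for at most [1 + m] grid
   radii. *)
rewrite /l mE opprD expRD [expR (- ln _)]expRN lnK ?posrE//.
rewrite mulrCA -[leRHS]mulr1 ler_pM2l ?expR_gt0//.
rewrite ler_pdivrMr// mul1r.
have : q * (b - a) <= m by rewrite /m ler_pM2l//; lra.
by lra.
Qed.

Section Localization.
Context (G : R -> R) (delta_ D : R).
Hypotheses (D0 : 0 < D) (deltaD : delta_ <= D)
  (excess_gt : forall s, tau_min <= s -> D <= `|s - s0| -> margin_at E s0 G s ->
     x s + 4 * s * Num.sqrt (rate n tau_max t) < (s ^+ 2 - E s) - (s0 ^+ 2 - E s0)).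

Let measurable_sh (i : interval R) : measurable (sh @^-1` [set` i]).
Proof. by rewrite -[_ @^-1` _]setTI; apply: msh => //; exact: measurable_itv. Qed.

Let ccE a b : [set w | a <= sh w <= b] = sh @^-1` `[a, b].
Proof. by apply/seteqP; split => w /=; rewrite in_itv. Qed.

Let ocE a b : [set w | a < sh w <= b] = sh @^-1` `]a, b].
Proof. by apply/seteqP; split => w /=; rewrite in_itv. Qed.

Let ltE b : [set w | sh w < b] = sh @^-1` `]-oo, b[.
Proof. by apply/seteqP; split => w /=; rewrite in_itv. Qed.

Lemma right_localization : right_margin E s0 delta_ tau_max G ->
  (P [set w | (s0 + D < sh w <= tau_max)%R] <= (expR (- t))%:E)%E.
Proof.
move=> hmargin; have [h|h] := ltP (s0 + D) tau_max; last first.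
  rewrite (_ : [set w | _] = set0) ?measure0 ?lee_fin ?expR_ge0//.
  apply/seteqP; split => w //= /andP[h1 h2].
  by have := lt_le_trans h1 (le_trans h2 h); rewrite ltxx.
have s0D : tau_min <= s0 + D by apply: (le_trans s0_ge); rewrite lerDl ltW.
apply: (@le_trans _ _ (P [set w | (s0 + D <= sh w <= tau_max)%R])).
  apply: le_measure; rewrite ?inE ?ocE ?ccE; [exact: measurable_sh.. |].
  by move=> w /=; rewrite !in_itv /= => /andP[/ltW -> ->].
apply: peeling => // s /andP[h1 h2].
have Ds : D < s - s0 by rewrite ltrBrDl.
apply: excess_gt; first exact: le_trans s0D (ltW h1).
  exact: le_trans (ltW Ds) (ler_norm _).
by apply: hmargin; rewrite h2 andbT (le_lt_trans _ h1)// lerD2l.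
Qed.

(** The left deviations are peeled on [[tau_min, s0 - D]], which lies below [tau_max]; each side
    costs one [exp (- t)]. *)
Lemma two_sided_localization : s0 <= tau_max ->
  two_sided_margin E tau_min s0 delta_ tau_max G ->
  (P [set w | (D < `|sh w - s0|)%R /\ (sh w <= tau_max)%R]
     <= (2 * expR (- t))%:E)%E.
Proof.
move=> s0_le hmargin.
have right := right_localization (fun s hs => hmargin s (or_intror hs)).
have left : (P [set w | (sh w < s0 - D)%R] <= (expR (- t))%:E)%E.
  have [h|h] := ltP tau_min (s0 - D); last first.
    rewrite (_ : [set w | _] = set0) ?measure0 ?lee_fin ?expR_ge0//.
    apply/seteqP; split => w //= h1.
    by have := lt_le_trans h1 (le_trans h (sh_ge w)); rewrite ltxx.
  have s0D : s0 - D < s0 by rewrite ltrBlDr ltrDl.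
  apply: (@le_trans _ _ (P [set w | (tau_min <= sh w <= s0 - D)%R])).
    apply: le_measure; rewrite ?inE ?ltE ?ccE; [exact: measurable_sh.. |].
    by move=> w /=; rewrite !in_itv /= => /ltW ->; rewrite sh_ge.
  apply: peeling => //; first exact: le_trans (ltW s0D) s0_le.
  move=> s /andP[h1 h2]; apply: excess_gt; first exact: ltW.
    by rewrite distrC; apply: le_trans (ler_norm _); rewrite lerBrDl -lerBrDr.
  by apply: hmargin; left; rewrite (ltW h1) (le_lt_trans h2).
rewrite (_ : [set w | _] = [set w | s0 + D < sh w <= tau_max] `|` [set w | sh w < s0 - D]).
  have mleft : measurable [set w | sh w < s0 - D] by rewrite ltE; exact: measurable_sh.
  have mright : measurable [set w | s0 + D < sh w <= tau_max].
    by rewrite ocE; exact: measurable_sh.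
  apply: (le_trans (measureU2 _ mright mleft)); apply: (le_trans (leeD right left)).
  by rewrite -EFinD lee_fin mulr_natl mulr2n.
have Dpos := D0; apply/seteqP; split => w /=.
  move=> [h1 h2]; have [h|h] := ltP (s0 + D) (sh w); first by left; rewrite h2.
  right; rewrite ltNge; apply/negP => h3; move: h1; rewrite ltNge => /negP; apply.
  by rewrite ler_norml; apply/andP; split; lra.
move=> [/andP[h1 h2]|h1]; split => //.
- by apply: lt_le_trans (ler_norm _); rewrite ltrBrDl.
- by rewrite distrC; apply: lt_le_trans (ler_norm _); rewrite ltrBrDl -ltrBrDr.
- by apply: le_trans s0_le; lra.
Qed.

End Localization.

End Peeling.

(** * Comparison of the deviation threshold with the margin *)

Section Radius.
Context (R : realType).
Implicit Types C K s q rho : R.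

(** Gives a single variance scale that serves both radii [s] and [s0]. The left side is already
    dominated by [(2 C s' + r0)^2]. *)
Lemma variance_le C K s s' s0 r0 e : 0 < C -> 0 <= s' -> 0 <= s -> 0 <= s0 -> 0 <= r0 ->
  s' <= s + s0 -> 4 * K * e <= C ^+ 2 * s' ^+ 2 + r0 ^+ 2 / 2 ->
  C ^+ 2 * s' ^+ 2 + 2 * K * e <= ((2 * C + 1) * (s + s0 + r0)) ^+ 2.
Proof.
move=> C0 s'0 sp s00 r00 ss hle.
have h1 : (2 * C * s' + r0) ^+ 2 <= ((2 * C + 1) * (s + s0 + r0)) ^+ 2.
  have h2 : 0 <= C * s' by rewrite mulr_ge0// ltW.
  have h3 : C * s' <= C * (s + s0) by rewrite ler_pM2l.
  have h4 : 0 <= C * r0 by rewrite mulr_ge0// ltW.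
  by rewrite lerXn2r ?nnegrE; lra.
have := mulr_ge0 (mulr_ge0 (ltW C0) s'0) r00.
by have := sqr_ge0 (C * s'); have := sqr_ge0 r0; lra.
Qed.

Lemma radius_le C K s s0 r0 q rho :
  0 <= C -> 0 <= K -> 0 <= s -> 0 <= s0 -> 0 <= r0 -> 0 <= q -> 0 <= rho ->
  1345 * ((2 * C + 1) * (s + s0 + r0) * q + 1344 * (K + 1) * rho) + 4 * s * q <=
  (1345 * (2 * C + 1) + 1345 * (1344 * (K + 1)) + 4) * ((s + s0 + r0) * q + rho).
Proof.
move=> C0 K0 sp s00 r00 q0 rho0.
have h1 : 0 <= (s0 + r0) * q by rewrite mulr_ge0// addr_ge0.
have h2 : 0 <= s * q by exact: mulr_ge0.
have h3 := mulr_ge0 K0 h1; have h4 := mulr_ge0 K0 h2; have h5 := mulr_ge0 C0 rho0.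
by lra.
Qed.

(* Young's inequality absorbs the part of the radius that is linear in the
   distance [u] of [s] to [s0] into half of [Gu]. *)
Lemma radius_lt_margin c s s0 r0 q rho u Gu g :
  0 < c -> 0 <= s0 -> 0 <= r0 -> 0 <= q -> 0 < rho -> 0 <= u -> s <= s0 + u ->
  4 * c * q * u - Gu <= g -> g + 4 * c * ((s0 + r0) * q + rho) <= Gu ->
  c * ((s + s0 + r0) * q + rho) < Gu.
Proof.
move=> c0 s00 r00 q0 rho0 u0 su young hGu.
have h1 : c * (s * q) <= c * ((s0 + u) * q) by rewrite ler_pM2l// ler_wpM2r.
have h2 : 0 <= c * (u * q) by rewrite mulr_ge0 ?mulr_ge0// ltW.
have h3 : 0 <= c * (r0 * q) by rewrite mulr_ge0 ?mulr_ge0// ltW.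
have h4 : 0 < c * rho by exact: mulr_gt0.
by lra.
Qed.

End Radius.

Theorem theorem4p1 (R : realType) (C K : R) (hC : 0 < C) :
  exists c0 : R, 0 < c0 /\
  forall (n : nat) (hn : (0 < n)%N)
    (d d' : measure_display) (Omega : measurableType d) (T : measurableType d')
    (P : probability Omega R) (X : 'I_n -> {mfun Omega >-> T})
    (hX : mutually_independent P X)
    (F : set (T -> R)) (pen : (T -> R) -> R)
    (hFmeas : forall f, F f -> measurable_fun setT f)
    (hFint : forall f, F f -> forall i,
      P.-integrable setT (fun w => (f (X i w))%:E))
    (hpen : forall f, F f -> 0 <= pen f)
    (fhat : Omega -> T -> R)
    (hfhat : forall w,
      unique_argmin F (fun f => emp_mean X f w + pen f) (fhat w))
    (f0 : T -> R) (hf0 : unique_argmin F (pop_mean P X) f0)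
    (tau_min : R) (htau_min0 : 0 <= tau_min)
    (htau_min : is_min [set tau2 P X f0 pen f | f in F] (tau_min ^+ 2))
    (hmax : forall s w, tau_min <= s ->
      exists m, is_max
        [set deviation P X f0 f w | f in sublevel P X F f0 pen s] m)
    (s0 : R)
    (hs0 : unique_argmin [set s | tau_min <= s]
      (fun s => s ^+ 2 - mean_E P X F f0 pen s) s0)
    (hsep : forall s, tau_min <= s ->
      separable_deviation P X f0 (sublevel P X F f0 pen s))
    (htaumeas : measurable_fun setT (fun w => tau P X f0 pen (fhat w)))
    (hK : is_max [set sup_norm (f \- f0) | f in F] K%:E)
    (m_n : R) (hm_n : 0 < m_n) (J : R -> R)
    (hJinc : {in `[tau_min, +oo[ &, {homo J : x y / x < y}})
    (hJ0 : J tau_min = 0)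
    (hJsurj : set_surj `[tau_min, +oo[ `]0, +oo[ J)
    (hPhi : strictly_convex_on `]0, +oo[ (Phi tau_min J))
    (hEJ : forall s, tau_min <= s -> mean_E P X F f0 pen s <= J s / m_n)
    (hcurv : forall f, F f ->
      avg_var P X (f \- f0) / C ^+ 2 <= pop_mean P X (f \- f0))
    (delta_ tau_max : R) (hdelta_ : 0 <= delta_)
    (htau_max : s0 + delta_ <= tau_max)
    (G : R -> R) (hG : margin_function G)
    (hmargin : right_margin (mean_E P X F f0 pen) s0 delta_ tau_max G)
    (r0 : R) (hr00 : 0 <= r0)
    (hr0 : ((r0 ^+ 2)%:E = (2 * C ^+ 2)%:E *
      convex_conjugate (Phi tau_min J) (4 * K / (m_n * C ^+ 2)))%E),
  exists delta : R -> R,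
    [/\ forall t, 0 < t -> 0 < delta t,
        forall t, 0 < t ->
          ((G (delta t))%:E <=
             convex_conjugate G (c0 * Num.sqrt (rate n tau_max t)) +
             (c0 * ((s0 + r0) * Num.sqrt (rate n tau_max t)
                    + rate n tau_max t))%:E)%E,
        forall t, 0 < t ->
          (P [set w | (s0 + Num.max delta_ (delta t) <
                       tau P X f0 pen (fhat w) <= tau_max)%R]
             <= (expR (- t))%:E)%E
      & two_sided_margin (mean_E P X F f0 pen) tau_min s0 delta_ tau_max G ->
        forall t, 0 < t ->
          (P [set w | (Num.max delta_ (delta t) <
                         `|tau P X f0 pen (fhat w) - s0|)%R /\
                      (tau P X f0 pen (fhat w) <= tau_max)%R]
             <= (2 * expR (- t))%:E)%E].
Proof.
(* The constant is fixed before [K] is known to be nonnegative, hence the absolute value; its three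
   summands are those of [radius_le]. *)
pose c1 := 1345 * (2 * C + 1) + 1345 * (1344 * (`|K| + 1)) + 4.
have c1_gt0 : 0 < c1 by have := normr_ge0 K; rewrite /c1; lra.
exists (4 * c1); split; first by rewrite mulr_gt0.
move=> n hn d d' Om T P X hX F pen hFmeas _ hpen fhat hfhat f0 [Ff0 _] tau_min
  tau_min0 htau_min hmax s0 [s0_ge _] hsep htaumeas hK m_n hm_n J hJinc hJ0 _ _ hEJ
  hcurv delta_ tau_max hdelta htau_max G hG hmargin r0 hr00 hr0.
have K0 : 0 <= K by exact: (@envelope_ge0 R K n hn d d' Om T P X F f0 Ff0 hK).
have s00 : 0 <= s0 by exact: le_trans s0_ge.
have s0_le : s0 <= tau_max by apply: le_trans htau_max; rewrite lerDl.
pose Eh s w := emp_E P X F f0 pen s w.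
pose E s := mean_E P X F f0 pen s.
pose sh w := tau P X f0 pen (fhat w).
pose q t := Num.sqrt (rate n tau_max t).
have nR0 : 0 < n%:R :> R by rewrite ltr0n.
pose l t := t + ln (1 + Num.sqrt (n%:R * tau_max ^+ 2)).
have l_gt0 t : 0 < t -> 0 < l t.
  by move=> t0; rewrite ltr_pwDl// ln_ge0// lerDl sqrtr_ge0.
have rate_gt0 t : 0 < t -> 0 < rate n tau_max t.
  by move=> t0; exact: divr_gt0 (l_gt0 _ t0) nR0.
have q_ge0 t : 0 <= q t by exact: sqrtr_ge0.
pose x t s := 1345 * ((2 * C + 1) * (s + s0 + r0) * q t + 1344 * (K + 1) * rate n tau_max t).
have bE s : tau_min <= s -> bounded_mfun (Eh s).
  by move=> st; exact: (bounded_mfun_emp_E hn hFmeas Ff0 hK hmax hsep st).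
have tail t : 0 < t -> forall s, tau_min <= s ->
    (P [set w | (x t s <= (Eh s w - E s) - (Eh s0 w - E s0))%R] <= (expR (- l t))%:E)%E.
  move=> t0 s st; have sp : 0 <= s by exact: le_trans st.
  have mgf s' : tau_min <= s' -> s' <= s + s0 -> forall z, 336 * `|z| * (2 * K) <= 1 ->
      mean P (fun w => expR (z * n%:R * (Eh s' w - E s'))) <=
      expR (336 * z ^+ 2 * n%:R * ((2 * C + 1) * (s + s0 + r0)) ^+ 2).
    move=> st' ss z zK.
    apply: (le_trans (mgf_emp_E hC hn hX hFmeas Ff0 hK hcurv hpen hmax hsep st' zK)).
    rewrite ler_expR; apply: ler_wpM2l.
      by apply: mulr_ge0; [apply: mulr_ge0 => //; exact: sqr_ge0 | exact: ltW].
    apply: variance_le => //; first exact: le_trans st'.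
    exact: mean_le_conjugate hC K0 hr00 hm_n st' hJinc hJ0 (hEJ _ st') hr0.
  have bUL s' : tau_min <= s' -> bounded_mfun (fun w => Eh s' w - E s').
    by move=> st'; apply: bounded_mfunB; [exact: bE | exact: bounded_mfun_cst].
  have C0 := ltW hC.
  rewrite /x; apply: two_point_tail => //.
  - exact: bUL.
  - exact: bUL.
  - by apply: mulr_ge0; [apply: addr_ge0 => //; exact: mulr_ge0 | rewrite !addr_ge0].
  - exact: l_gt0.
  - by apply: mgf => //; rewrite lerDl.
  - by apply: mgf => //; rewrite lerDr.
have sh_ge w : tau_min <= sh w.
  by apply: (tau_ge tau_min0 htau_min); have [] := hfhat w.
have erm w : sh w ^+ 2 - Eh (sh w) w <= s0 ^+ 2 - Eh s0 w.
  have [Ffh hmin] := hfhat w.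
  apply: (erm_excess hFmeas Ff0 hK tau_min0 htau_min hmax Ffh _ s0_ge) => f Ff.
  by have [->//|/(hmin _ Ff)/ltW] := pselect (f = fhat w).
have homo s s' w : tau_min <= s -> s <= s' -> Eh s w <= Eh s' w.
  by move=> st ss'; exact: (emp_E_homo hmax).
(* The right side of the required bound on [G (delta t)] when the conjugate has the finite value
   [g]; [delta t] will solve [G = B] exactly. *)
pose B t g := g + 4 * c1 * ((s0 + r0) * q t + rate n tau_max t).
have excess_gt t g dt : 0 < t -> (forall u, 0 < u -> 4 * c1 * q t * u - G u <= g) ->
    0 < dt -> G dt = B t g -> forall s, tau_min <= s -> Num.max delta_ dt <= `|s - s0| ->
    margin_at E s0 G s -> x t s + 4 * s * q t < (s ^+ 2 - E s) - (s0 ^+ 2 - E s0).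
  move=> t0 conj dt0 Gdt s st; rewrite ge_max => /andP[_ dts].
  have sp : 0 <= s by exact: le_trans st.
  apply: lt_le_trans; apply: (@le_lt_trans _ _ (c1 * ((s + s0 + r0) * q t + rate n tau_max t))).
    by rewrite /x /c1 (ger0_norm K0); apply: radius_le => //; apply: ltW => //; exact: rate_gt0.
  apply: (radius_lt_margin c1_gt0 s00 hr00 (q_ge0 t) (rate_gt0 _ t0) (normr_ge0 (s - s0)) (g := g)).
  - by rewrite -lerBlDl ler_norm.
  - by apply: conj; exact: lt_le_trans dts.
  - by rewrite -/(B t g) -Gdt; apply: (margin_function_homo hG) => //; exact: ltW.
suff /choice[delta hdel] : forall t, exists dt, 0 < t ->
    [/\ 0 < dt,
      ((G dt)%:E <= convex_conjugate G (4 * c1 * q t) +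
        (4 * c1 * ((s0 + r0) * q t + rate n tau_max t))%:E)%E,
      (P [set w | (s0 + Num.max delta_ dt < sh w <= tau_max)%R] <= (expR (- t))%:E)%E &
      two_sided_margin E tau_min s0 delta_ tau_max G ->
      (P [set w | (Num.max delta_ dt < `|sh w - s0|)%R /\ (sh w <= tau_max)%R]
         <= (2 * expR (- t))%:E)%E].
  exists delta; split=> [t t0|t t0|t t0|htwo t t0]; have [h1 h2 h3 h4] := hdel t t0 => //.
  exact: h4.
(* For [t <= 0] nothing is claimed and 0 is a default value. *)
move=> t; have [t0|t0] := ltP 0 t; last by exists 0.
have conj_ge u : 0 < u ->
    ((4 * c1 * q t * u - G u)%:E <= convex_conjugate G (4 * c1 * q t))%E.
  by move=> u0; apply: ereal_sup_ubound; exists u => //=; rewrite in_itv /= u0.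
case conjE : (convex_conjugate G (4 * c1 * q t)) => [g| |].
- have conj u : 0 < u -> 4 * c1 * q t * u - G u <= g.
    by move=> /conj_ge; rewrite conjE lee_fin.
  have c1q : 0 <= 4 * c1 * q t by apply: mulr_ge0 => //; rewrite mulr_ge0// ltW.
  have B0 : 0 < B t g.
    rewrite /B ltr_wpDl ?(convex_conjugate_ge0 hG c1q conj)//.
    rewrite mulr_gt0 ?mulr_gt0// ltr_wpDl ?rate_gt0//.
    by rewrite mulr_ge0 ?addr_ge0.
  have [dt dt0 Gdt] := margin_function_onto hG B0.
  have D0 : 0 < Num.max delta_ dt by rewrite lt_max dt0 orbT.
  have deltaD : delta_ <= Num.max delta_ dt by rewrite le_max lexx.
  have hexc := excess_gt t g dt t0 conj dt0 Gdt.
  exists dt => _; split => //.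
  + by rewrite -EFinD lee_fin Gdt.
  + exact: (right_localization hn t0 htaumeas tau_min0 sh_ge erm homo bE s0_ge
      (tail t t0) D0 deltaD hexc).
  + exact: (two_sided_localization hn t0 htaumeas tau_min0 sh_ge erm homo bE s0_ge
      (tail t t0) D0 deltaD hexc s0_le).
(* When the conjugate is infinite, the bound on [G] holds for every value; [tau_max + 1] makes both
   events empty. *)
- have tm0 : 0 <= tau_max by exact: le_trans s0_le.
  have D_gt : tau_max < Num.max delta_ (tau_max + 1) by rewrite lt_max ltrDl ltr01 orbT.
  exists (tau_max + 1) => _; split; first by rewrite ltr_wpDl.
  + by rewrite addye ?leey.
  + rewrite (_ : [set w | _] = set0) ?measure0 ?lee_fin ?expR_ge0//.
    apply/seteqP; split => w //= /andP[h1 h2].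
    have : tau_max < tau_max.
      apply: (lt_le_trans D_gt).
      by rewrite (le_trans _ (le_trans (ltW h1) h2))// lerDr.
    by rewrite ltxx.
  + move=> _; rewrite (_ : [set w | _] = set0).
      by rewrite measure0 lee_fin mulr_ge0// expR_ge0.
    apply/seteqP; split => w //= -[h1 h2].
    have := lt_trans D_gt h1; rewrite ltNge => /negP; apply.
    have sp := le_trans tau_min0 (sh_ge w).
    rewrite ler_norml lerBlDr (le_trans h2) ?lerDl// andbT.
    by rewrite lerBrDl (le_trans (_ : _ <= 0))// subr_le0.
(* The conjugate is at least its real value at [u = 1], which excludes minus infinity. *)
- by have := conj_ge 1 ltr01; rewrite conjE.
Qed.
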